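(* Fix real numbers $\theta,\lambda,\delta$ with $0<\theta<1/2$, $0<\lambda<1$, $\theta<\delta<\lambda$ and $\delta+\lambda<1$. For $N\in\mathbb{N}$ put $h=[N^{\theta}]$, $D=[N^{\delta}]$, $Q=[N^{\lambda}]$. Let $g_1,g:\mathbb{N}\to\mathbb{R}$ be such that $g_1(d)=0$ for $d>D$, $g(q)=0$ for $q>Q$, $g_1(d)\ge 1$ for $1\le d\le D$, $g(q)\ge 1$ for $1\le q\le Q$, and $g_1(n)\ll_\varepsilon N^{\varepsilon}$, $g(n)\ll_\varepsilon N^{\varepsilon}$ for every $\varepsilon>0$. Put $f_1=g_1\ast\mathbf{1}$ and $f=g\ast\mathbf{1}$, i.e. $f_1(n)=\sum_{d\mid n}g_1(d)$, $f(n)=\sum_{q\mid n}g(q)$. Then, as $N\to\infty$, $$I_{f,f_1}(N,h)=2N\sum_{1<\ell\le D}\ell^2R_\ell(f)R_\ell(f_1)\sum_{t\mid \ell}\frac{\mu(t)}{t^2}\Big\Vert\frac{h}{\ell/t}\Big\Vert+o(Nh),$$ and consequently, with an absolute implied constant, $$I_{f,f_1}(N,h)\gg N\sum_{1<\ell\le D/2}\ \sum_{d\le D/\ell}\frac{g_1(\ell d)}{d}\sum_{q\le Q/\ell}\frac{g(\ell q)}{q}\sum_{t\mid\ell}\frac{\mu(t)}{t^2}\Big\Vert\frac{h}{\ell/t}\Big\Vert.$$ If moreover $g(\ell q)\ge g(q)$ for all $\ell\le Q$ and all $q\le Q/\ell$, then, with an absolute implied constant, $$I_{f,f_1}(N,h)\gg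 N\Big(\sum_{q\le Q/D}\frac{g(q)}{q}\Big)\sum_{1<\ell\le D/2}\ \sum_{d\le D/\ell}\frac{g_1(\ell d)}{d}\sum_{t\mid\ell}\frac{\mu(t)}{t^2}\Big\Vert\frac{h}{\ell/t}\Big\Vert.$$
   Context: $\mathbf{1}$ denotes the constant function $1$ on $\mathbb{N}$, $\ast$ is Dirichlet convolution, $\mu$ is the Möbius function, and $\Vert\alpha\Vert=\min_{n\in\mathbb{Z}}|\alpha-n|$. Set ${\rm sgn}(0)=0$ and ${\rm sgn}(r)=r/|r|$ for $r\ne0$. For real arithmetic functions $f,f_1$ the mixed symmetry integral is $$I_{f,f_1}(N,h)=\int_N^{2N}\sum_{|n-x|\le h}{\rm sgn}(n-x)f(n)\sum_{|m-x|\le h}{\rm sgn}(m-x)f_1(m)\,dx,$$ where $n,m$ run over positive integers and $x$ is real. For an arithmetic function $F$ such that $G=F\ast\mu$ has finite support and satisfies $G(n)\ll_\varepsilon N^\varepsilon$ for every $\varepsilon>0$, the Ramanujan coefficients are $R_\ell(F)=\sum_{m\ge1,\ \ell\mid m}\frac{(F\ast\mu)(m)}{m}=\frac1\ell\sum_{n\ge1}\frac{G(\ell n)}{n}$. *)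

(* Defs.v *)
From mathcomp Require Import all_boot all_order all_algebra.
From mathcomp Require Import all_classical all_reals all_analysis.

Set Implicit Arguments.
Unset Strict Implicit.
Unset Printing Implicit Defensive.

Import Order.TTheory GRing.Theory Num.Theory.
Import numFieldNormedType.Exports.

Local Open Scope classical_set_scope.
Local Open Scope ring_scope.

(* Arithmetic functions are encoded as functions on [nat] of which only the
   values at positive integers are meaningful. *)

Definition moebius (n : nat) : int :=
  if [forall p : 'I_n.+1, prime p ==> ~~ (p ^ 2 %| n)%N]
  then (-1) ^+ size (primes n) else 0.

Definition dirichlet_conv (R : realType) (F G : nat -> R) (n : nat) : R :=
  \sum_(d <- divisors n) F d * G (n %/ d)%N.

(* The infimum is attained, so this is the minimum over the integers. *)
Definition dist_int (R : realType) (x : R) : R :=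
  inf (range (fun n : int => `|x - n%:~R|)).

Definition symmetry_sum (R : realType) (F : nat -> R) (h : nat) (x : R) : R :=
  \sum_(n \in [set n : nat | (0 < n)%N /\ `|n%:R - x| <= h%:R])
     Num.sg (n%:R - x) * F n.

Definition symmetry_integral (R : realType) (F F1 : nat -> R) (N h : nat) : R :=
  \int[@lebesgue_measure R]_(x in `[N%:R, 2 * N%:R])
     (symmetry_sum F h x * symmetry_sum F1 h x).

(* The limit of the partial sums over 1 <= m < M; the sequence is eventually
   constant when [F * moebius] has finite support. *)
Definition ramanujan_coef (R : realType) (l : nat) (F : nat -> R) : R :=
  limn (fun M : nat => \sum_(1 <= m < M | (l %| m)%N)
    dirichlet_conv F (fun n => (moebius n)%:~R) m / m%:R).

Definition floor_pow (R : realType) (a : R) (N : nat) : nat :=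
  Num.truncn (N%:R `^ a).

(* [g N] is the function attached to the parameter [N]; the constant in the
   bound by [N `^ e] depends on [e] and on the family, not on [N] or [n]. *)
Definition sieve_weight (R : realType) (a : R) (g : nat -> nat -> R) : Prop :=
  [/\ forall N n, (0 < N)%N -> (floor_pow a N < n)%N -> g N n = 0,
      forall N n, (0 < N)%N -> (1 <= n <= floor_pow a N)%N -> 1 <= g N n &
      forall e : R, 0 < e -> exists C : R,
        forall N n, (0 < N)%N -> (0 < n)%N -> `|g N n| <= C * N%:R `^ e].

Definition conv_one (R : realType) (g : nat -> R) : nat -> R :=
  dirichlet_conv g (fun=> 1).

Definition moebius_dist_sum (R : realType) (h l : nat) : R :=
  \sum_(t <- divisors l)
     (moebius t)%:~R / t%:R ^+ 2 * dist_int (h%:R / (l%:R / t%:R)).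

(* Main.v *)
(* All functions involved are constant between consecutive integers, so the
   integral is a sum over [N <= m < 2 N] of products of
   [T_f(m) = \sum_q g(q) X_q(m)], where the [q]-periodic function [X_q]
   ([asym] in the code) is attached to the multiples of [q].  Conditioning on
   residues modulo [e = gcd(q, d)] shows that the mean of [X_q X_d] is
   [2 e^2 ||h / e|| / (q d)]; Moebius inversion of [e^2 ||h / e||] over the
   divisors of [e] turns the sum of these means into the main term.

   The deviation from the mean is bounded through the finite Fourier expansion of
   [X_q], whose coefficients at [a / q] are at most [min(2 h, 2 / |sin (pi a / q)|)],
   and geometric sums, which give
   [h \sum_(b < d) tau_d(b) (d tau_d(b q mod d) + \sum_(i <= q) 1 / i)] with
   [tau_d(r) = 1 / r + 1 / (d - r)].  Averaged over [q <= Q], the residues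
   [b q mod d] are equidistributed, so that all pairs together contribute
   [O(h Q D log^2 Q)], which is [o(N h)] since [delta + lambda < 1].

   For the lower bounds, the coefficients of the main term are nonnegative, as
   inversion writes them as mean squares, and its diagonal part alone is at least
   [N h], so it dominates the error. *)

Require Import Defs.
From mathcomp Require Import all_boot all_order all_algebra.
From mathcomp Require Import all_classical all_reals all_analysis.
From mathcomp Require Import measurable_realfun.
From mathcomp Require Import zify ring lra.
Import Order.TTheory GRing.Theory Num.Theory.
Import numFieldNormedType.Exports.
Local Open Scope classical_set_scope.
Local Open Scope ring_scope.

Set Implicit Arguments.
Unset Strict Implicit.
Unset Printing Implicit Defensive.

(** * Sums of periodic sequences *)

Lemma sum_nat_shift_periodic (V : zmodType) (F : nat -> V) (p t : nat) :
  (forall m, F (m + p)%N = F m) ->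
  \sum_(0 <= m < p) F (m + t)%N = \sum_(0 <= m < p) F m.
Proof.
move=> Fp; elim: t => [|t IHt]; first by apply: eq_bigr => m _; rewrite addn0.
(* Both windows are completed to the same [p.+1] terms, whose first and last values agree by
   periodicity. *)
rewrite -IHt; apply: (@addrI _ (F (0 + t)%N)).
have -> : F (0 + t)%N + \sum_(0 <= m < p) F (m + t.+1)%N =
          \sum_(0 <= m < p.+1) F (m + t)%N.
  rewrite big_nat_recl //; congr (_ + _).
  by apply: eq_bigr => m _; rewrite addSnnS.
by rewrite big_nat_recr //= addrC; congr (_ + _); rewrite add0n addnC Fp.
Qed.

Lemma sum_nat_mul (V : nmodType) (F : nat -> V) (a b : nat) :
  \sum_(0 <= m < a * b) F m =
  \sum_(0 <= r < a) \sum_(0 <= k < b) F (r + a * k)%N.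
Proof.
elim: b => [|b IHb].
  by rewrite muln0 big_geq // big1 // => r _; rewrite big_geq.
rewrite (@big_cat_nat _ _ _ (a * b)) //=; last by rewrite leq_mul.
rewrite IHb.
under [in RHS]eq_bigr => r _ do rewrite big_nat_recr //=.
rewrite big_split /=; congr (_ + _).
rewrite -{1}[(a * b)%N]add0n big_addn mulnS addnK.
by apply: eq_bigr.
Qed.

Lemma sum_nat_mul_periodic (V : nmodType) (F : nat -> V) (p k : nat) :
  (forall m, F (m + p)%N = F m) ->
  \sum_(0 <= m < p * k) F m = (\sum_(0 <= m < p) F m) *+ k.
Proof.
move=> Fp; rewrite sum_nat_mul -sumrMnl; apply: eq_bigr => r _.
rewrite (eq_bigr (fun=> F r)) ?sumr_const_nat ?subn0 // => i _.
by elim: i => [|i IHi]; rewrite ?muln0 ?addn0 // mulnSr addnA Fp.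
Qed.

(** Multiplication by a unit [q] permutes the residues modulo [d]. *)
Lemma sum_nat_mod_coprime (V : nmodType) (F : nat -> V) (q d : nat) :
  coprime q d -> \sum_(0 <= k < d) F ((q * k) %% d)%N = \sum_(0 <= k < d) F k.
Proof.
case: d => [|d] cop; first by rewrite !big_geq.
pose h (k : 'I_d.+1) : 'I_d.+1 := inord ((q * k) %% d.+1).
have hE k : h k = ((q * k) %% d.+1)%N :> nat by rewrite inordK // ltn_mod.
have h_inj : injective h.
  move=> i j /(congr1 (@nat_of_ord _)); rewrite !hE => /eqP eq_ij; apply: val_inj.
  wlog le_ij : i j eq_ij / (i <= j)%N.
    by case/orP: (leq_total i j) => ? H; [|apply/esym]; apply: H; rewrite // eq_sym.
  move: eq_ij; rewrite eq_sym eqn_mod_dvd ?leq_mul // -mulnBr Gauss_dvdr;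
    last by rewrite coprime_sym.
  have := ltn_ord j; rewrite /dvdn => ltj.
  rewrite modn_small; last by apply: leq_ltn_trans ltj; rewrite leq_subr.
  by rewrite subn_eq0 => le_ji; apply/eqP; rewrite eqn_leq le_ij.
rewrite !big_mkord [RHS](reindex_inj h_inj) /=.
by apply: eq_bigr => k _; rewrite hE.
Qed.

(** With $e=\gcd(q,d)$ and $k=j+(d/e)i$, the residue of $qk$ is $e$ times that of $(q/e)j$ modulo
    $d/e$, independent of $i$; the coprime case then applies. *)
Lemma sum_nat_mod_gcd (V : nmodType) (F : nat -> V) (q d : nat) : (0 < d)%N ->
  \sum_(0 <= k < d) F ((q * k) %% d)%N =
  (\sum_(0 <= i < d %/ gcdn q d) F (gcdn q d * i)%N) *+ gcdn q d.
Proof.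
move=> d0; set e := gcdn q d.
have e0 : (0 < e)%N by rewrite gcdn_gt0 d0 orbT.
have [/divnK qE /divnK dE] : (e %| q)%N /\ (e %| d)%N.
  by rewrite dvdn_gcdl dvdn_gcdr.
set q' := (q %/ e)%N in qE *; set d' := (d %/ e)%N in dE *.
have cop : coprime q' d'.
  by rewrite /coprime -(eqn_pmul2r e0) muln_gcdl qE dE mul1n.
rewrite -[in X in \sum_(0 <= _ < X) _]dE sum_nat_mul -sumrMnl.
rewrite -(sum_nat_mod_coprime (fun i => F (e * i)%N *+ e) cop).
apply: eq_bigr => j _; rewrite (eq_bigr (fun=> F (e * ((q' * j) %% d'))%N)).
  by rewrite sumr_const_nat subn0.
move=> i _; congr F; rewrite muln_modr [(e * d')%N]mulnC dE.
have -> : (q * (j + d' * i) = q' * i * d + e * (q' * j))%N.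
  by rewrite -[in LHS]qE -[in RHS]dE; ring.
by rewrite modnMDl.
Qed.

(** * The mean of [X_q X_d] *)

(* For [m = k + h] this is the inner sum of the symmetry integral on
   ]m, m + 1[ for the indicator function of the multiples of [q]; the shift by
   [h] keeps all indices natural. *)
Definition asym (R : pzRingType) (h q k : nat) : R :=
  \sum_(0 <= i < h) ((q %| k + h + 1 + i)%:R - (q %| k + 1 + i)%:R).

Lemma asym_periodic (R : pzRingType) (h q k : nat) :
  asym R h q (k + q) = asym R h q k.
Proof.
apply: eq_bigr => i _.
have -> : (k + q + h + 1 + i = q + (k + h + 1 + i))%N by lia.
have -> : (k + q + 1 + i = q + (k + 1 + i))%N by lia.
by rewrite !(dvdn_addr _ (dvdnn q)).
Qed.

Lemma asym_modn (R : pzRingType) (h q r m : nat) :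
  asym R h q (r + m %% q) = asym R h q (r + m).
Proof.
rewrite {2}(divn_eq m q) addnCA; elim: (m %/ q)%N => [|j IHj] //.
by rewrite mulSn -addnA [(q + _)%N]addnC asym_periodic.
Qed.

(** When [e] divides [n], division by [e] turns the progression into [d %/ e] consecutive integers,
    exactly one of which is a multiple of [d %/ e]. *)
Lemma sum_dvdn_progression (d e n : nat) : (0 < d)%N -> (e %| d)%N ->
  (\sum_(0 <= i < d %/ e) (d %| n + e * i) = (e %| n))%N.
Proof.
move=> d0 /dvdnP[d' dE]; move: d0; rewrite {}dE muln_gt0 => /andP[d0 e0].
rewrite mulnK //; case: (boolP (e %| n)%N) => [/dvdnP[n' ->]|nen]; last first.
  apply: big1 => i _; apply/eqP; rewrite eqb0; apply: contra nen => den.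
  rewrite -(@dvdn_addl (e * i) e n) ?dvdn_mulr //.
  by apply: dvdn_trans den; rewrite dvdn_mull.
rewrite (eq_bigr (fun i => (d' %| i + n')%N : nat)); last first.
  by move=> i _; rewrite [(n' * e)%N]mulnC -mulnDr [(n' + i)%N]addnC
    [(d' * e)%N]mulnC dvdn_pmul2l.
have := @sum_nat_shift_periodic int (fun m => (d' %| m)%:R) d' n'.
rewrite -!natr_sum => /(_ _)/eqP; rewrite eqr_nat => /(_ _)/eqP -> //; last first.
  by move=> m; rewrite dvdn_addl.
rewrite big_ltn // dvdn0 big_nat big1 // => i /andP[i0 ltid].
by rewrite gtnNdvd.
Qed.

(** This is the conditioning step: $X_d$, summed over the residues modulo [d] in one class modulo
    [e], collapses to $X_e$. *)
Lemma asym_progression (R : pzRingType) (h d e k : nat) :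
  (0 < d)%N -> (e %| d)%N ->
  \sum_(0 <= i < d %/ e) asym R h d (k + e * i) = asym R h e k.
Proof.
move=> d0 ed; rewrite exchange_big /=; apply: eq_bigr => j _.
rewrite big_split /= sumrN -!natr_sum; congr (_%:R - _%:R).
  rewrite -(sum_dvdn_progression (k + h + 1 + j) d0 ed).
  by apply: eq_bigr => i _; congr (nat_of_bool (dvdn _ _)); lia.
rewrite -(sum_dvdn_progression (k + 1 + j) d0 ed).
by apply: eq_bigr => i _; congr (nat_of_bool (dvdn _ _)); lia.
Qed.

(** For a fixed residue [r] modulo [q], the arguments of $X_d$ run through the class of [r] modulo
    $e=\gcd(q,d)$, each residue $e$ times, so $X_d$ collapses to $X_e$; then $X_q$ collapses in the
    same way. *)
Lemma sum_asym_mul (R : comPzRingType) (h q d : nat) : (0 < q)%N -> (0 < d)%N ->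
  \sum_(0 <= m < q * d) asym R h q m * asym R h d m =
  (\sum_(0 <= m < gcdn q d) asym R h (gcdn q d) m ^+ 2) *+ gcdn q d.
Proof.
move=> q0 d0; rewrite sum_nat_mul.
have per p r m : asym R h p (r + p * m)%N = asym R h p r.
  by rewrite -asym_modn mulnC modnMl addn0.
under eq_bigr => r _.
  under eq_bigr => k _ do rewrite per -[asym R h d _]asym_modn.
  rewrite -big_distrr /= (sum_nat_mod_gcd (fun j => asym R h d (r + j)%N)) //.
  rewrite asym_progression ?dvdn_gcdr //.
  over.
under eq_bigr => r _ do rewrite mulrnAr.
rewrite sumrMnl; congr (_ *+ _); move: (dvdn_gcdl q d); set e := gcdn q d => eq.
rewrite -{1}(divnK eq) mulnC sum_nat_mul; apply: eq_bigr => r _.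
under eq_bigr => i _ do rewrite [asym R h e _]per.
by rewrite -big_distrl /= asym_progression.
Qed.

Lemma sum_dvdn_divn (q k n : nat) : (0 < q)%N ->
  (k %/ q + \sum_(0 <= i < n) (q %| k + 1 + i) = (k + n) %/ q)%N.
Proof.
move=> q0; elim: n => [|n IHn]; first by rewrite big_geq // !addn0.
by rewrite big_nat_recr //= addnA IHn [(k + n.+1)%N]addnS divnS // addnC addn1 addSn.
Qed.

(** Counting multiples by quotients exhibits $X_q$ as a second difference of $k\mapsto\lfloor
    k/q\rfloor$ with step [h]. *)
Lemma asym_divn (R : comPzRingType) (h q k : nat) : (0 < q)%N ->
  asym R h q k =
  ((k + h + h) %/ q)%:R - ((k + h) %/ q)%:R *+ 2 + (k %/ q)%:R.
Proof.
move=> q0; rewrite /asym big_split /= sumrN -!natr_sum.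
rewrite -(sum_dvdn_divn (k + h) h q0) -(sum_dvdn_divn k h q0) !natrD.
ring.
Qed.

Lemma sum_leqC (e a : nat) : (\sum_(0 <= k < e) (a <= k) = e - a)%N.
Proof.
elim: e => [|e IHe]; first by rewrite big_geq.
by rewrite big_nat_recr //= IHe; case: leqP => ?; lia.
Qed.

Lemma sum_ltnC (e a : nat) : (\sum_(0 <= k < e) (k < a) = minn e a)%N.
Proof.
elim: e => [|e IHe]; first by rewrite big_geq // min0n.
by rewrite big_nat_recr //= IHe; case: (ltnP e a) => ?; lia.
Qed.

(** For $k<e$ the second difference depends on $h$ only through $r=h\bmod e$ and lies in
    $\{-1,0,1\}$. It is nonzero for exactly $2\min(r,e-r)$ values of $k$: the last $2r$ if $2r\le
    e$, the first $2(e-r)$ otherwise. *)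
Lemma sum_asym_sqr (R : comPzRingType) (h e : nat) : (0 < e)%N ->
  \sum_(0 <= m < e) asym R h e m ^+ 2 = (2 * minn (h %% e) (e - h %% e))%:R.
Proof.
move=> e0; have ltr := ltn_pmod h e0; set r := (h %% e)%N in ltr *.
have asymE k : (k < e)%N -> asym R h e k =
    ((e <= k + 2 * r) + (2 * e <= k + 2 * r))%:R - (e <= k + r)%:R *+ 2.
  move=> ltk; rewrite asym_divn // (divn_small ltk) addr0.
  have kh (j : nat) : ((k + j * r + j * (h %/ e) * e) %/ e =
      j * (h %/ e) + (k + j * r) %/ e)%N by rewrite [(_ + _ * e)%N]addnC divnMDl.
  have -> : (k + h = k + 1 * r + 1 * (h %/ e) * e)%N.
    by rewrite {1}(divn_eq h e) -/r; ring.
  have -> : (k + 1 * r + 1 * (h %/ e) * e + h = k + 2 * r + 2 * (h %/ e) * e)%N.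
    by rewrite {2}(divn_eq h e) -/r; ring.
  (* All arguments are below [3 * e], so a quotient is a sum of two threshold indicators. *)
  have small m : (m < 3 * e)%N -> (m %/ e = (e <= m) + (2 * e <= m))%N.
    move=> ltm; case: (leqP e m) => lem; last by rewrite divn_small //; lia.
    case: (leqP (2 * e)%N m) => le2m.
      by rewrite -(subnKC le2m) divnMDl // [X in (_ + X)%N]divn_small //; lia.
    by rewrite -(subnKC lem) -{1}[e]mul1n divnMDl // [X in (_ + X)%N]divn_small //; lia.
  rewrite !kh !mul1n (small (k + 2 * r)%N) ?(small (k + r)%N); try lia.
  have -> : (2 * e <= k + r)%N = false by lia.
  by rewrite addn0 [X in X - _]natrD natrM [X in _ - X *+ 2]natrD; ring.
case: (leqP (2 * r)%N e) => le2r.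
  have -> : minn r (e - r) = r by lia.
  transitivity (\sum_(0 <= k < e) ((e - 2 * r <= k)%N%:R : R)); last first.
    by rewrite -natr_sum sum_leqC; congr _%:R; lia.
  rewrite big_nat [RHS]big_nat; apply: eq_bigr => k /= ltk; rewrite asymE //.
  have -> : (2 * e <= k + 2 * r)%N = false by lia.
  have -> : (e - 2 * r <= k)%N = (e <= k + 2 * r)%N by lia.
  by case: (leqP e (k + r)) => ?; case: (leqP e (k + 2 * r)) => ?; try lia;
    rewrite natrD /= ?mulr0n ?mulr1n; ring.
have -> : minn r (e - r) = (e - r)%N by lia.
transitivity (\sum_(0 <= k < e) ((k < 2 * (e - r))%N%:R : R)); last first.
  by rewrite -natr_sum sum_ltnC; congr _%:R; lia.
rewrite big_nat [RHS]big_nat; apply: eq_bigr => k /= ltk; rewrite asymE //.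
have -> : (e <= k + 2 * r)%N = true by lia.
have -> : (k < 2 * (e - r))%N = ~~ (2 * e <= k + 2 * r)%N by lia.
by case: (leqP e (k + r)) => ?; case: (leqP (2 * e) (k + 2 * r)) => ?; try lia;
  rewrite natrD /= ?mulr0n ?mulr1n; ring.
Qed.

(** The value $e^2\Vert h/e\Vert$, which is a natural number. *)
Definition sym_energy (h e : nat) : nat := (e * minn (h %% e) (e - h %% e))%N.

Lemma sum_asym_mulE (R : comPzRingType) (h q d : nat) :
  (0 < q)%N -> (0 < d)%N ->
  \sum_(0 <= m < q * d) asym R h q m * asym R h d m =
  (2 * sym_energy h (gcdn q d))%:R.
Proof.
move=> q0 d0; rewrite sum_asym_mul // sum_asym_sqr ?gcdn_gt0 ?q0 //.
by rewrite /sym_energy -mulr_natr -natrM; congr _%:R; ring.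
Qed.

Lemma dist_int_frac (R : realType) (h e : nat) : (0 < e)%N ->
  dist_int (h%:R / e%:R : R) = (minn (h %% e) (e - h %% e))%:R / e%:R.
Proof.
move=> e0; have ltr := ltn_pmod h e0.
have e0R : 0 < e%:R :> R by rewrite ltr0n.
have frac (n : int) :
    `|h%:R / e%:R - n%:~R| = (absz (Posz h - n * Posz e)%R)%:R / e%:R :> R.
  rewrite -[in LHS](mulfK (lt0r_neq0 e0R) n%:~R) -mulrBl normrM normfV.
  by rewrite [`|e%:R|]gtr0_norm // natr_absz intr_norm rmorphB rmorphM.
apply/eqP; rewrite eq_le; apply/andP; split.
- apply: ge_inf; first by exists 0 => _ [n _ <-]; exact: normr_ge0.
  case: (leqP (h %% e) (e - h %% e)) => le_r.
    exists (Posz (h %/ e)) => //; rewrite frac; congr (_%:R / _).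
    rewrite {1}(divn_eq h e); lia.
  exists (Posz (h %/ e).+1) => //; rewrite frac; congr (_%:R / _).
  rewrite {1}(divn_eq h e); lia.
- apply: lb_le_inf; first by exists `|h%:R / e%:R - 0%:~R|; exists 0.
  move=> _ [n _ <-]; rewrite frac ler_pM2r ?invr_gt0 // ler_nat.
  rewrite {3}(divn_eq h e).
  (* With $j=\lfloor h/e\rfloor-n$ the numerator is $je+(h\bmod e)$: at least $h\bmod e$ for
     $j\ge0$, at most $(h\bmod e)-e$ for $j\le-1$. *)
  have : (Posz (h %/ e) - n >= 0) || (Posz (h %/ e) - n <= -1) by lia.
  set j := _ - n => /orP jP.
  have -> : Posz (h %/ e * e + h %% e) - n * e = j * e + Posz (h %% e).
    by rewrite /j PoszD PoszM; ring.
  by case: jP => jP; nia.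
Qed.

Lemma sqr_dist_int (R : realType) (h e : nat) : (0 < e)%N ->
  e%:R ^+ 2 * dist_int (h%:R / e%:R : R) = (sym_energy h e)%:R.
Proof.
move=> e0; rewrite dist_int_frac // /sym_energy natrM.
by field; rewrite pnatr_eq0 -lt0n.
Qed.

(** * The Moebius function *)

Lemma moebius_sqfree (n : nat) : (0 < n)%N ->
  (forall p, prime p -> ~~ (p ^ 2 %| n)%N) -> moebius n = (-1) ^+ size (primes n).
Proof.
move=> n0 sqf; rewrite /moebius; case: ifP => // /negP[].
by apply/forallP => p; apply/implyP; exact: sqf.
Qed.

Lemma moebius_eq0 (n p : nat) : (0 < n)%N -> prime p -> (p ^ 2 %| n)%N ->
  moebius n = 0.
Proof.
move=> n0 pp pn; rewrite /moebius; case: ifP => // /forallP.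
have ltp : (p < n.+1)%N.
  by apply: leq_trans (dvdn_leq n0 pn); rewrite -{1}(expn1 p) leq_exp2l // prime_gt1.
by move=> /(_ (Ordinal ltp)) /=; rewrite pp pn.
Qed.

Lemma moebius1 : moebius 1 = 1.
Proof.
rewrite moebius_sqfree // => p pp; apply/negP => /(dvdn_leq (ltn0Sn 0)).
by have := prime_gt1 pp; nia.
Qed.

Lemma moebius_primeM (p d : nat) : prime p -> (0 < d)%N -> ~~ (p %| d)%N ->
  moebius (p * d) = - moebius d.
Proof.
move=> pp d0 pd; have p0 := prime_gt0 pp.
have pd0 : (0 < p * d)%N by rewrite muln_gt0 p0.
case: (boolP [forall q : 'I_d.+1, prime q ==> ~~ (q ^ 2 %| d)%N]) => [sqf|].
  have {}sqf q : prime q -> ~~ (q ^ 2 %| d)%N.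
    move=> qp; case: (ltnP q d.+1) => [ltq|leq].
      by have /forallP/(_ (Ordinal ltq)) := sqf; rewrite /= qp.
    by apply/negP => /(dvdn_leq d0); have := prime_gt1 qp; nia.
  rewrite !moebius_sqfree // => [|q qp].
    have -> : size (primes (p * d)) = (size (primes d)).+1.
      rewrite -[(size _).+1]/(size (p :: primes d)); apply: perm_size.
      apply: uniq_perm; first exact: primes_uniq.
        by rewrite /= primes_uniq mem_primes (negPf pd) !andbF.
      by move=> q; rewrite primesM // primes_prime // !inE.
    by rewrite exprS mulN1r.
  case: (eqVneq q p) => [->|neq].
    by rewrite expnS expn1 dvdn_pmul2l.
  rewrite Gauss_dvdr ?sqf // coprimeXl // prime_coprime //.
  by rewrite dvdn_prime2.
rewrite negb_forall => /existsP[q]; rewrite negb_imply negbK => /andP[qp qd].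
by rewrite (moebius_eq0 d0 qp qd) (moebius_eq0 pd0 qp) ?oppr0 // dvdn_mull.
Qed.

(** The free upper bound [b] lets divisor sums of different [n] share one range, so that they can be
    exchanged with other sums. *)
Lemma big_divisors (V : nmodType) (F : nat -> V) (n b : nat) :
  (0 < n < b)%N ->
  \sum_(d <- divisors n) F d = \sum_(0 <= d < b) (if (d %| n)%N then F d else 0).
Proof.
move=> /andP[n0 ltnb]; rewrite -big_mkcond -big_filter; apply: perm_big.
apply: uniq_perm; rewrite ?divisors_uniq ?filter_uniq ?iota_uniq // => d.
rewrite -dvdn_divisors // mem_filter mem_index_iota leq0n /=.
case: (boolP (d %| n)%N) => //= /(dvdn_leq n0) led.
by rewrite (leq_ltn_trans led).
Qed.

(* Divisors divisible by a fixed prime factor [p] cancel against the others;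
   those divisible by [p ^ 2] contribute 0. *)
Lemma sum_moebius (n : nat) : (0 < n)%N ->
  \sum_(d <- divisors n) moebius d = (n == 1)%N%:R.
Proof.
move=> n0; case: eqVneq => [->|n1]; first by rewrite big_seq1 moebius1.
pose p := pdiv n; have pp : prime p by apply: pdiv_prime; lia.
have pn : (p %| n)%N := pdiv_dvd n.
rewrite (bigID (fun d => p %| d)%N) /= addrC.
have -> : \sum_(d <- divisors n | ~~ (p %| d)%N) moebius d =
    \sum_(0 <= d < n.+1) (if (d %| n)%N && ~~ (p %| d)%N then moebius d else 0).
  rewrite big_mkcond (@big_divisors _ _ _ n.+1) ?n0 ?ltnS //=.
  by apply: eq_bigr => d _; case: (d %| n)%N; case: (p %| d)%N.
have -> : \sum_(d <- divisors n | (p %| d)%N) moebius d =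
    \sum_(0 <= d < n.+1) (if (d %| n)%N && ~~ (p %| d)%N then - moebius d else 0).
  rewrite big_mkcond (@big_divisors _ _ _ (p * n.+1)) /=; last first.
    by rewrite n0 /=; have := prime_gt1 pp; nia.
  rewrite sum_nat_mul [LHS]big_ltn ?prime_gt0 //=.
  rewrite [\sum_(1 <= r < p) _]big1_seq ?addr0 => [|r]; last first.
    rewrite mem_index_iota => /= /andP[r0 ltrp].
    apply: big1 => k _; have -> : (p %| r + p * k)%N = false.
      by rewrite dvdn_addl ?dvdn_mulr // gtnNdvd.
    by case: ifP.
  rewrite big_nat [RHS]big_nat; apply: eq_bigr => d _.
  rewrite add0n dvdn_mulr //; case: (boolP (p %| d)%N) => pd.
    rewrite andbF; case: ifP => // pdn; apply: (@moebius_eq0 _ p) => //.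
      by apply: dvdn_gt0 pdn.
    by rewrite expnS expn1 dvdn_mul.
  have cop : coprime p d by rewrite prime_coprime.
  rewrite Gauss_dvd // pn andbT /=; case: ifP => // dn.
  by rewrite moebius_primeM // (dvdn_gt0 _ dn).
rewrite -big_split big1 //= => d _.
by case: ifP; rewrite ?subrr ?addr0.
Qed.

(** * Dirichlet inversion *)

Lemma sum_nat_pick (V : nmodType) (F : nat -> V) (i b : nat) :
  \sum_(0 <= j < b) (if j == i then F j else 0) = if (i < b)%N then F i else 0.
Proof. by rewrite -big_mkcond big_nat1_eq. Qed.

(** A form symmetric in both factors, in which commutativity and associativity become exchanges of
    summation. *)
Lemma dirichlet_convE (R : realType) (F G : nat -> R) (n b : nat) : (0 < n < b)%N ->
  dirichlet_conv F G n =
  \sum_(0 <= x < b) \sum_(0 <= y < b) (if (x * y == n)%N then F x * G y else 0).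
Proof.
move=> /andP[n0 ltnb]; rewrite /dirichlet_conv (@big_divisors _ _ _ b) ?n0 //.
apply: eq_bigr => x _; case: ifP => [/dvdnP[y ny]|xn]; last first.
  by rewrite big1 // => y _; case: eqP => // xyn; rewrite -xyn dvdn_mulr in xn.
have [x0 y0] : (0 < x)%N /\ (0 < y)%N by move: n0; rewrite ny muln_gt0 => /andP[].
have ltyb : (y < b)%N by nia.
have := sum_nat_pick (fun y => F x * G y) y b; rewrite ltyb ny mulnK // => <-.
by apply: eq_bigr => z _; rewrite mulnC eqn_pmul2r.
Qed.

Lemma eq_dirichlet_conv (R : realType) (F F' G G' : nat -> R) (n : nat) :
  (0 < n)%N -> (forall m, (0 < m)%N -> F m = F' m) ->
  (forall m, (0 < m)%N -> G m = G' m) ->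
  dirichlet_conv F G n = dirichlet_conv F' G' n.
Proof.
move=> n0 FF' GG'; apply: eq_big_seq => d; rewrite -dvdn_divisors // => dn.
have d0 := dvdn_gt0 n0 dn.
by rewrite (FF' _ d0) GG' // divn_gt0 // dvdn_leq.
Qed.

Lemma dirichlet_convC (R : realType) (F G : nat -> R) (n : nat) : (0 < n)%N ->
  dirichlet_conv F G n = dirichlet_conv G F n.
Proof.
move=> n0; rewrite !(@dirichlet_convE _ _ _ _ n.+1) ?n0 ?ltnS //=.
rewrite exchange_big; apply: eq_bigr => x _; apply: eq_bigr => y _.
by rewrite mulnC mulrC.
Qed.

Lemma dirichlet_conv3E (R : realType) (F G H : nat -> R) (n b : nat) :
  (0 < n < b)%N ->
  dirichlet_conv (dirichlet_conv F G) H n =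
  \sum_(0 <= x < b) \sum_(0 <= y < b) \sum_(0 <= z < b)
    (if (x * y * z == n)%N then F x * G y * H z else 0).
Proof.
move=> /[dup] nb /andP[n0 ltnb]; rewrite (dirichlet_convE _ _ nb) exchange_big /=.
transitivity (\sum_(0 <= z < b) \sum_(0 <= x < b) \sum_(0 <= y < b)
    (if (x * y * z == n)%N then F x * G y * H z else 0)); last first.
  by rewrite exchange_big /=; apply: eq_bigr => x _; rewrite exchange_big.
apply: eq_bigr => z _.
transitivity (\sum_(0 <= w < b) \sum_(0 <= x < b) \sum_(0 <= y < b)
    (if (w * z == n)%N then if (x * y == w)%N then F x * G y * H z else 0 else 0)).
  rewrite big_nat [RHS]big_nat; apply: eq_bigr => w /= ltw.
  case: eqP => [wzn|_]; last by rewrite big1 // => x _; rewrite big1.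
  rewrite (@dirichlet_convE _ _ _ w b) ?ltw ?andbT; last by nia.
  rewrite big_distrl; apply: eq_bigr => x _; rewrite big_distrl /=.
  by apply: eq_bigr => y _; case: ifP; rewrite ?mul0r.
rewrite exchange_big; apply: eq_bigr => x _ /=.
rewrite exchange_big; apply: eq_bigr => y _ /=.
(* If [x * y] lies outside the range of [w], the right side is zero as well: [x * y * z = n] with
   [z > 0] would force [n >= b]. *)
have [xyb|bxy] := ltnP (x * y) b.
  have := sum_nat_pick (fun w => if (w * z == n)%N then F x * G y * H z else 0) (x * y) b.
  rewrite xyb => <-; apply: eq_bigr => w _.
  by rewrite [w == _]eq_sym; case: (_ * z == n)%N; case: (_ == w)%N.
rewrite big_nat big1 => [|w ltw].
  case: eqP => // xyzn; move: n0; rewrite -xyzn muln_gt0 => /andP[_ z0].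
  by have := leq_pmulr (x * y) z0; lia.
by case: ifP => // _; case: eqP => // ?; lia.
Qed.

(** One use of commutativity makes both sides triple sums over $xyz=n$ that differ by a cyclic
    relabelling. *)
Lemma dirichlet_convA (R : realType) (F G H : nat -> R) (n : nat) : (0 < n)%N ->
  dirichlet_conv (dirichlet_conv F G) H n = dirichlet_conv F (dirichlet_conv G H) n.
Proof.
move=> n0; rewrite [RHS]dirichlet_convC //.
rewrite !(@dirichlet_conv3E _ _ _ _ _ n.+1) ?n0 ?leqnn //.
rewrite exchange_big; apply: eq_bigr => y _ /=.
rewrite exchange_big; apply: eq_bigr => z _ /=; apply: eq_bigr => x _.
have -> : (y * z * x = x * y * z)%N by ring.
by case: eqP => // _; ring.
Qed.

Definition moebiusR (R : realType) (n : nat) : R := (moebius n)%:~R.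

Lemma conv_one_moebiusR (R : realType) (n : nat) : (0 < n)%N ->
  conv_one (@moebiusR R) n = (n == 1)%N%:R.
Proof.
move=> n0; rewrite /conv_one /dirichlet_conv.
under eq_bigr do rewrite mulr1.
by rewrite -rmorph_sum sum_moebius //= rmorph_nat.
Qed.

Lemma dirichlet_conv1 (R : realType) (F : nat -> R) (n : nat) : (0 < n)%N ->
  dirichlet_conv F (fun m => (m == 1)%N%:R) n = F n.
Proof.
move=> n0; rewrite /dirichlet_conv (bigD1_seq n) ?divisors_uniq //=; last first.
  by rewrite -dvdn_divisors.
rewrite divnn n0 mulr1 big_seq_cond big1 ?addr0 // => d /andP[].
rewrite -dvdn_divisors // => /dvdnP[k ->]; case: d => [|d]; rewrite ?muln0 //.
rewrite mulnK // => neq; case: eqP => [k1|_]; last by rewrite mulr0.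
by rewrite k1 mul1n eqxx in neq.
Qed.

Lemma moebius_inversion (R : realType) (F : nat -> R) (n : nat) : (0 < n)%N ->
  dirichlet_conv (conv_one F) (@moebiusR R) n = F n.
Proof.
move=> n0; rewrite dirichlet_convA // -[RHS]dirichlet_conv1 //.
apply: eq_dirichlet_conv => // m m0; rewrite dirichlet_convC //.
exact: conv_one_moebiusR.
Qed.

Lemma conv_one_dirichlet_moebius (R : realType) (F : nat -> R) (n : nat) :
  (0 < n)%N -> conv_one (dirichlet_conv (@moebiusR R) F) n = F n.
Proof.
move=> n0; rewrite /conv_one -[RHS]dirichlet_conv1 //.
rewrite (@eq_dirichlet_conv _ _ (dirichlet_conv F (@moebiusR R)) _ (fun=> 1)) //.
  rewrite dirichlet_convA //; apply: eq_dirichlet_conv => // m m0.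
  exact: conv_one_moebiusR.
by move=> m m0; rewrite dirichlet_convC.
Qed.

(** The indicator of the multiples of [c] is the convolution of the point mass at [c] with $\mathbf
    1$, so Moebius inversion returns the point mass. *)
Lemma sum_moebius_multiples (R : realType) (c n : nat) : (0 < n)%N ->
  \sum_(q <- divisors n) (c %| q)%N%:R * moebiusR R (n %/ q) = (c == n)%N%:R.
Proof.
move=> n0; rewrite -(@moebius_inversion R (fun m => (c == m)%N%:R)) //.
apply: eq_dirichlet_conv => // m m0; rewrite /conv_one /dirichlet_conv.
under eq_bigr do rewrite mulr1.
rewrite (@big_divisors _ _ _ m.+1) ?m0 ?leqnn //.
case: (ltnP c m.+1) => [ltc|ltc].
  have := sum_nat_pick (fun d => (d %| m)%N%:R : R) c m.+1.
  rewrite ltc => <-; apply: eq_bigr => d _.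
  by rewrite [d == _]eq_sym; case: eqP => _; case: (_ %| m)%N.
rewrite gtnNdvd // big_nat big1 // => d ltd.
by case: ifP => // _; case: eqP => //; lia.
Qed.

(** * Ramanujan coefficients and the weights of the main term *)

Lemma ramanujan_coefE (R : realType) (l b : nat) (G : nat -> R) :
  (forall n, (b <= n)%N -> G n = 0) ->
  ramanujan_coef l (conv_one G) = \sum_(1 <= m < b | (l %| m)%N) G m / m%:R.
Proof.
move=> G0; rewrite /ramanujan_coef; apply: lim_near_cst => //.
exists b => // M /= leM.
rewrite [RHS](big_nat_widen _ _ M) // [LHS]big_nat_cond [RHS]big_nat_cond.
rewrite big_mkcond [RHS]big_mkcond; apply: eq_bigr => m _.
case: m => [|m]; first by [].
have -> : dirichlet_conv (conv_one G) (fun n => (moebius n)%:~R) m.+1 = G m.+1.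
  exact: moebius_inversion.
case: (ltnP m.+1 b) => [?|/G0 ->]; first by rewrite andbT.
by rewrite mul0r andbF !andbF; case: ifP.
Qed.

(** Since $\ell^2/t^2=(\ell/t)^2$, each summand becomes $\mu(t)$ times the energy at $\ell/t$. *)
Lemma moebius_dist_sumE (R : realType) (h l : nat) : (0 < l)%N ->
  l%:R ^+ 2 * moebius_dist_sum R h l =
  dirichlet_conv (@moebiusR R) (fun e => (sym_energy h e)%:R) l.
Proof.
move=> l0; rewrite big_distrr; apply: eq_big_seq => t /=.
rewrite -dvdn_divisors // => tl; have t0 := dvdn_gt0 l0 tl.
have lt0 : (0 < l %/ t)%N by rewrite divn_gt0 // (dvdn_leq l0 tl).
rewrite -sqr_dist_int // -natf_div // natf_div // /moebiusR.
by field; rewrite pnatr_eq0 -lt0n.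
Qed.

(** Inversion of the previous identity. Applied at $e=\gcd(q,d)$, it splits the gcd into separate
    divisibility conditions on [q] and [d]. *)
Lemma sum_moebius_dist_sum (R : realType) (h e b : nat) : (0 < e < b)%N ->
  \sum_(0 <= l < b) (if (l %| e)%N then l%:R ^+ 2 * moebius_dist_sum R h l else 0) =
  (sym_energy h e)%:R :> R.
Proof.
move=> /[dup] eb /andP[e0 _].
rewrite -(@conv_one_dirichlet_moebius R (fun e => (sym_energy h e)%:R)) //.
rewrite /conv_one {1}/dirichlet_conv (big_divisors _ eb).
apply: eq_bigr => l _; case: ifP => // le.
by rewrite mulr1 moebius_dist_sumE // (dvdn_gt0 e0 le).
Qed.

(* By inversion [2 l ^+ 2 * moebius_dist_sum h l] is the mean square over a
   period [l] of [\sum_(q %| l) mu (l / q) q asym q]. *)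
Lemma moebius_dist_sum_ge0 (R : realType) (h l : nat) :
  (0 < l)%N -> 0 <= moebius_dist_sum R h l.
Proof.
move=> l0; have l0R : 0 < l%:R :> R by rewrite ltr0n.
pose k j : R := j%:R ^+ 2 * moebius_dist_sum R h j.
pose a q : R := moebiusR R (l %/ q).
suff : (2 * l)%:R * k l = \sum_(0 <= m < l)
    (\sum_(q <- divisors l) a q * q%:R * asym R h q m) ^+ 2.
  move=> kE; have : 0 <= (2 * l)%:R * k l by rewrite kE sumr_ge0 // => m _; exact: sqr_ge0.
  rewrite pmulr_rge0 ?ltr0n ?muln_gt0 //.
  by rewrite /k pmulr_rge0 // exprn_gt0.
transitivity (\sum_(q <- divisors l) \sum_(d <- divisors l)
    a q * a d * (2 * l * sym_energy h (gcdn q d))%:R).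
(* [sum_moebius_multiples] isolates [j = l] inside a sum over all [j]; expanding the squares and
   summing over the common divisors [j] of [q] and [d] produces the energy at their gcd. *)
- transitivity (\sum_(0 <= j < l.+1) (2 * l)%:R * k j *
      (\sum_(q <- divisors l) (j %| q)%N%:R * a q) ^+ 2).
    rewrite big_nat_recr //= sum_moebius_multiples // eqxx expr1n mulr1.
    rewrite big_nat big1 ?add0r // => j ltj.
    rewrite sum_moebius_multiples //; case: eqP => [|_]; first by lia.
    by rewrite expr0n mulr0.
  transitivity (\sum_(0 <= j < l.+1) \sum_(q <- divisors l) \sum_(d <- divisors l)
      (2 * l)%:R * k j * (((j %| q)%N%:R * a q) * ((j %| d)%N%:R * a d))).
    apply: eq_bigr => j _; rewrite expr2 big_distrlr big_distrr.
    by apply: eq_bigr => q _; rewrite big_distrr.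
  rewrite exchange_big; apply: eq_big_seq => q; rewrite -dvdn_divisors // => ql.
  rewrite exchange_big; apply: eq_big_seq => d; rewrite -dvdn_divisors // => dl.
  have q0 := dvdn_gt0 l0 ql.
  have gl : (0 < gcdn q d < l.+1)%N.
    by rewrite gcdn_gt0 q0 ltnS (dvdn_leq l0 (dvdn_trans (dvdn_gcdl q d) ql)).
  rewrite [in RHS]natrM -(sum_moebius_dist_sum R h gl) !big_distrr; apply: eq_bigr => j _ /=.
  rewrite dvdn_gcd; case: (j %| q)%N; case: (j %| d)%N; rewrite /= ?mulr0 ?mul0r ?mulr0 //.
  by rewrite -/(k j); ring.
- transitivity (\sum_(q <- divisors l) \sum_(d <- divisors l) \sum_(0 <= m < l)
      (a q * q%:R * asym R h q m) * (a d * d%:R * asym R h d m)); last first.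
    under eq_bigr => q _ do rewrite exchange_big /=.
    rewrite exchange_big; apply: eq_bigr => m _ /=.
    by rewrite expr2 big_distrlr.
  apply: eq_big_seq => q; rewrite -dvdn_divisors // => ql.
  apply: eq_big_seq => d; rewrite -dvdn_divisors // => dl.
  have [q0 d0] := (dvdn_gt0 l0 ql, dvdn_gt0 l0 dl).
  have per p i m : (p %| i)%N -> asym R h p (m + i) = asym R h p m.
    by move=> pi; rewrite -asym_modn (eqP pi) addn0.
  pose F m := asym R h q m * asym R h d m.
  have Fqd m : F (m + q * d)%N = F m.
    by rewrite /F (per q) ?dvdn_mulr // (per d) ?dvdn_mull.
  have Fl m : F (m + l)%N = F m by rewrite /F !per.
  (* [F] has both periods [l] and [q * d], so its sum over [l * (q * d)] terms is computed in two
     ways. *)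
  have := sum_nat_mul_periodic l Fqd; rewrite mulnC (sum_nat_mul_periodic _ Fl).
  rewrite (sum_asym_mulE _ _ q0 d0) -[LHS]mulr_natr -[RHS]mulr_natr => FE.
  transitivity (a q * a d * ((\sum_(0 <= m < l) F m) * (q * d)%:R)).
    by rewrite FE !natrM; ring.
  rewrite mulr_suml mulr_sumr; apply: eq_bigr => m _.
  by rewrite /F natrM; ring.
Qed.

(** * Finite Fourier expansion *)

Lemma natr_double (R : pzRingType) (n : nat) : n.*2%:R = 2 * n%:R :> R.
Proof. by rewrite -mul2n natrM. Qed.

Lemma natr_doubleS (R : pzRingType) (n : nat) : n.*2.+1%:R = 2 * n%:R + 1 :> R.
Proof. by rewrite -natr1 natr_double. Qed.

Lemma sin_nat_pi (R : realType) (n : nat) : sin (pi * n%:R) = 0 :> R.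
Proof.
by rewrite -[_ * _]add0r mulr_natr alternatingn ?sin0 ?mulr0 //; exact: sinDpi.
Qed.

Lemma cos_2nat_pi (R : realType) (n : nat) : cos (pi * n.*2%:R) = 1 :> R.
Proof.
rewrite -[_ * _]add0r mulr_natr -mul2n mulrnA (periodicn (@cosD2pi R)).
exact: cos0.
Qed.

Lemma cosD_odd_pi (R : realType) (x : R) (n : nat) :
  cos (x + pi * n.*2.+1%:R) = - cos x.
Proof.
rewrite -addn1 natrD mulrDr mulr1 addrA cosDpi; congr (- _).
by rewrite mulr_natr -mul2n mulrnA (periodicn (@cosD2pi R)).
Qed.

Lemma norm_sin_modn (R : realType) (c n : nat) : (0 < n)%N ->
  `|sin (pi * (c%:R / n%:R) : R)| = `|sin (pi * ((c %% n)%:R / n%:R))|.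
Proof.
move=> n0; rewrite {1}(divn_eq c n).
have -> : pi * ((c %/ n * n + c %% n)%:R / n%:R) =
    pi * ((c %% n)%:R / n%:R) + pi *+ (c %/ n) :> R.
  by rewrite natrD natrM -mulr_natr; field; rewrite pnatr_eq0 -lt0n.
by rewrite alternatingn ?normrM ?normrX ?normrN1 ?expr1n ?mul1r //; exact: sinDpi.
Qed.

(** With $y=x/2$: $\sin x=2\sin y\cos y$, the mean value theorem gives $\sin y\ge y\cos y$, and
    $\cos 2y\ge0$ gives $\cos^2y\ge1/2$. *)
Lemma sin_ge_half (R : realType) (x : R) : 0 <= x <= pi / 2 -> x / 2 <= sin x.
Proof.
move=> /andP[x0 xpi].
have pi0 := @pi_gt0 R.
have [->|xn0] := eqVneq x 0; first by rewrite sin0 mul0r.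
have {xn0}x0 : 0 < x by rewrite lt_neqAle eq_sym xn0.
have cosx : 0 <= cos x by apply: cos_ge0_pihalf; apply/andP; split=> //; lra.
pose y := x / 2; have y0 : 0 < y by rewrite /y; lra.
have xE : x = y *+ 2 by rewrite /y -mulr_natr; lra.
have siny : y * cos y <= sin y.
  have [z /itvP zP] := @MVT R (@sin R) (@cos R) 0 y y0
    (fun z _ => is_derive_sin z)
    (continuous_subspaceT (@continuous_sin R)).
  rewrite sin0 !subr0 => ->; rewrite mulrC ler_pM2r //.
  have z0 : 0 < z by rewrite zP.
  have zy : z < y by rewrite zP.
  have yE : y = x / 2 by [].
  rewrite leNgt ltr_cos ?in_itv /=; first by rewrite -leNgt ltW.
    by apply/andP; split; lra.
  by apply/andP; split; lra.
have cosy : 0 <= cos y by apply: cos_ge0_pihalf; apply/andP; split; rewrite /y; lra.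
have cos2y : 1 / 2 <= cos y ^+ 2 by move: cosx; rewrite xE cos_mulr2n; lra.
rewrite {2}xE sin_mulr2n -mulr_natr.
have : y * (cos y ^+ 2) <= cos y * sin y by rewrite expr2 mulrA [leRHS]mulrC ler_wpM2r.
have : y * (1 / 2) <= y * cos y ^+ 2 by rewrite ler_wpM2l // ltW.
rewrite /y; lra.
Qed.

(** The bound for geometric sums of ratio $e^{2\pi iz}$; it is $0$ at integers, by $0^{-1}=0$. *)
Definition csc_norm (R : realType) (z : R) : R := `|sin (pi * z)|^-1.

(* [0^-1 = 0], so for [r < n] only the summand at [n - r] survives at [r = 0]. *)
Definition tau (R : realType) (n r : nat) : R := r%:R^-1 + (n - r)%:R^-1.

Lemma tau_ge0 (R : realType) (n r : nat) : 0 <= tau R n r.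
Proof. by rewrite addr_ge0 ?invr_ge0. Qed.

(** For $2m\le n$, [sin_ge_half] and $\pi\ge2$ give $\sin(\pi m/n)\ge m/n$; the reflection $c\mapsto
    n-c$ covers the other half, and [tau] bounds both cases at once. *)
Lemma csc_norm_le (R : realType) (c n : nat) : (c < n)%N ->
  csc_norm (c%:R / n%:R) <= n%:R * tau R n c.
Proof.
move=> ltcn; have n0 : (0 < n)%N by lia.
have n0R : 0 < n%:R :> R by rewrite ltr0n.
have pi0 := @pi_gt0 R; have pi2 := @pi_ge2 R.
have key (m : nat) : (0 < m)%N -> (m.*2 <= n)%N ->
    m%:R / n%:R <= sin (pi * (m%:R / n%:R)) :> R.
  move=> m0 le2m; have mn0 : 0 <= m%:R / n%:R :> R by rewrite divr_ge0.
  have mn2 : m%:R / n%:R <= 1 / 2 :> R.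
    rewrite ler_pdivrMr //; move: le2m; rewrite -(ler_nat R) natr_double.
    lra.
  apply: le_trans (sin_ge_half _); last by apply/andP; split; nra.
  nra.
have key' (m : nat) : (0 < m)%N -> (m.*2 <= n)%N ->
    csc_norm (m%:R / n%:R) <= n%:R * m%:R^-1 :> R.
  move=> m0 le2m; have := key m m0 le2m.
  have mn0 : 0 < m%:R / n%:R :> R by rewrite divr_gt0 ?ltr0n.
  move=> le_sin; have sin0 := lt_le_trans mn0 le_sin.
  rewrite /csc_norm gtr0_norm //.
  have -> : n%:R * m%:R^-1 = (m%:R / n%:R)^-1 :> R by rewrite invf_div.
  by rewrite lef_pV2.
case: (posnP c) => [->|c0].
  by rewrite /csc_norm mul0r mulr0 sin0 normr0 invr0 mulr_ge0 // tau_ge0.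
case: (leqP c.*2 n) => [le2c|lt2c].
  by apply: le_trans (key' c c0 le2c) _; rewrite ler_wpM2l // lerDl invr_ge0.
have -> : csc_norm (c%:R / n%:R) = csc_norm ((n - c)%:R / n%:R) :> R.
  rewrite /csc_norm natrB ?(ltnW ltcn) // mulrBl divff ?lt0r_neq0 // mulrBr mulr1.
  by rewrite sinB sinpi cospi mul0r add0r mulN1r opprK.
have := key' (n - c)%N; rewrite subn_gt0 ltcn => /(_ isT) H.
by apply: le_trans (H _) _; [lia|rewrite ler_wpM2l // lerDr invr_ge0].
Qed.

(** Orthogonality of the additive characters modulo [q], in real form. If [q] does not divide [n],
    multiplication by $2\sin(\pi n/q)\ne0$ makes the sum telescope to zero. *)
Lemma sum_cos_dvdn (R : realType) (q n : nat) : (0 < q)%N ->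
  (q %| n)%N%:R = q%:R^-1 *
    \sum_(0 <= a < q) cos (pi * (a%:R / q%:R) * n.*2%:R) :> R.
Proof.
move=> q0; have q0R : q%:R != 0 :> R by rewrite pnatr_eq0 -lt0n.
case: (boolP (q %| n)%N) => [/dvdnP[j ->]|qn].
  rewrite (eq_bigr (fun=> 1)) => [|a _]; last first.
    rewrite -[RHS](cos_2nat_pi R (a * j)); congr cos.
    by rewrite -!mul2n !natrM; field.
  by rewrite sumr_const_nat subn0 mulVf.
have sz : sin (pi * (n%:R / q%:R)) != 0 :> R.
  rewrite -normr_eq0 norm_sin_modn // normr_eq0 lt0r_neq0 // sin_gt0_pi //.
  have r0 : (0 < n %% q)%N by rewrite lt0n.
  rewrite mulr_gt0 ?pi_gt0 ?divr_gt0 ?ltr0n //= -[ltRHS]mulr1 ltr_pM2l ?pi_gt0 //.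
  by rewrite ltr_pdivrMr ?ltr0n // mul1r ltr_nat ltn_mod.
set z := n%:R / q%:R in sz.
apply/esym/eqP; rewrite mulf_eq0 invr_eq0 (negPf q0R) /=.
have tele m : sin (pi * z) * (\sum_(0 <= a < m) cos (pi * (a%:R / q%:R) * n.*2%:R)) *+ 2
    = sin (pi * z * (m.*2%:R - 1)) + sin (pi * z).
  elim: m => [|m IHm].
    by rewrite big_geq // mulr0 mul0rn double0 sub0r mulrN1 sinN addrC subrr.
  rewrite big_nat_recr //= mulrDr mulrnDl IHm.
  have -> : pi * (m%:R / q%:R) * n.*2%:R = pi * z * m.*2%:R :> R.
    by rewrite /z -!mul2n !natrM; field.
  rewrite [m.+1.*2%:R]natr_double -[m.+1%:R]natr1.
  have -> : pi * z * (2 * (m%:R + 1) - 1) = pi * z * m.*2%:R + pi * z.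
    by rewrite natr_double; ring.
  have -> : pi * z * (m.*2%:R - 1) = pi * z * m.*2%:R - pi * z by ring.
  by rewrite sinB sinD -mulr_natr; ring.
have : sin (pi * z) * (\sum_(0 <= a < q) cos (pi * (a%:R / q%:R) * n.*2%:R)) *+ 2 = 0.
  rewrite tele mulrBr mulr1.
  have -> : pi * z * q.*2%:R = pi * n.*2%:R by rewrite /z -!mul2n !natrM; field.
  by rewrite sinB cos_2nat_pi sin_nat_pi mul0r mul1r sub0r addrC subrr.
by move/eqP; rewrite mulrn_eq0 /= mulf_eq0 (negPf sz).
Qed.

(** Up to the factor $-1/q$, the Fourier coefficient of [asym h q] at $y=a/q$, with phases taken
    about the half-integer $k+h+1/2$. *)
Definition sin_sum (R : realType) (h : nat) (y : R) : R :=
  (\sum_(0 <= i < h) sin (pi * y * i.*2.+1%:R)) *+ 2.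

Lemma norm_sin_sum (R : realType) (h : nat) (y : R) : `|sin_sum h y| <= 2 * h%:R.
Proof.
rewrite normrMn -[leLHS]mulr_natl ler_pM2l // (le_trans (ler_norm_sum _ _ _)) //.
rewrite (le_trans (ler_sum _ (fun i _ => sin_max _))) //.
by rewrite sumr_const_nat subn0.
Qed.

Lemma sin_mul_sin_sum (R : realType) (h : nat) (y : R) :
  sin (pi * y) * sin_sum h y = 1 - cos (pi * y * h.*2%:R).
Proof.
elim: h => [|h IHh]; first by rewrite /sin_sum big_geq // mul0rn !mulr0 cos0 subrr.
rewrite /sin_sum big_nat_recr //= mulrnDl mulrDr -/(sin_sum h y) IHh.
have -> : pi * y * h.*2.+1%:R = pi * y * h.*2%:R + pi * y.
  by rewrite -natr1 mulrDr mulr1.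
have -> : pi * y * h.+1.*2%:R = pi * y * h.*2%:R + (pi * y) *+ 2.
  by rewrite !natr_double -[h.+1%:R]natr1 -[(pi * y) *+ 2]mulr_natr; ring.
rewrite cosD sinD sin_mulr2n cos_mulr2n cos2sin2.
by ring.
Qed.

Lemma norm_sin_sum_csc (R : realType) (h b d : nat) : (b < d)%N ->
  `|sin_sum h (b%:R / d%:R : R)| <= 2 * csc_norm (b%:R / d%:R).
Proof.
move=> ltbd; case: (posnP b) => [->|b0].
  rewrite mul0r /sin_sum big1 => [|i _]; last by rewrite mulr0 mul0r sin0.
  by rewrite mul0rn normr0 mulr_ge0 ?invr_ge0.
set y := b%:R / d%:R.
have d0 : (0 < d)%N by lia.
have sy : 0 < sin (pi * y) :> R.
  rewrite sin_gt0_pi // mulr_gt0 ?pi_gt0 ?divr_gt0 ?ltr0n //=.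
  rewrite -[ltRHS]mulr1 ltr_pM2l ?pi_gt0 //.
  by rewrite ltr_pdivrMr ?ltr0n // mul1r ltr_nat.
rewrite ler_pdivlMr ?normr_gt0 ?lt0r_neq0 // -normrM mulrC sin_mul_sin_sum.
have := cos_max (pi * y * h.*2%:R); rewrite !ler_norml => /andP[? ?].
by apply/andP; split; lra.
Qed.

(** The window is symmetric about $k+h+1/2$: reversing its lower half pairs $k+h+1+i$ with $k+h-i$,
    and the difference of the two cosines is $-2$ times a product of sines. *)
Lemma asym_fourier (R : realType) (h q k : nat) : (0 < q)%N ->
  asym R h q k = - (q%:R^-1 * \sum_(0 <= a < q)
    sin_sum h (a%:R / q%:R) * sin (pi * (a%:R / q%:R) * (k + h).*2.+1%:R)).
Proof.
move=> q0; rewrite /asym big_split /= sumrN.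
rewrite [X in _ - X]big_nat_rev /= -sumrB.
transitivity (\sum_(0 <= i < h) q%:R^-1 * \sum_(0 <= a < q)
   - (sin (pi * (a%:R / q%:R) * i.*2.+1%:R) *+ 2 *
     sin (pi * (a%:R / q%:R) * (k + h).*2.+1%:R : R))).
  rewrite big_nat [RHS]big_nat; apply: eq_bigr => i /= ltih.
  rewrite !sum_cos_dvdn // -mulrBr -sumrB; congr (_ * _); apply: eq_bigr => a _.
  set y := pi * (a%:R / q%:R).
  have -> : (k + 1 + (0 + h - i.+1) = k + h - i)%N by lia.
  rewrite !natr_doubleS !natr_double natrB; last by lia.
  rewrite !natrD.
  have -> : y * (2 * (k%:R + h%:R + 1 + i%:R)) =
      y * (2 * (k%:R + h%:R) + 1) + y * (2 * i%:R + 1) by ring.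
  have -> : y * (2 * (k%:R + h%:R - i%:R)) =
      y * (2 * (k%:R + h%:R) + 1) - y * (2 * i%:R + 1) by ring.
  rewrite cosD cosB -mulr_natr; ring.
rewrite -big_distrr /= exchange_big -mulrN -sumrN; congr (_ * _).
apply: eq_bigr => a _ /=; rewrite sumrN -big_distrl /= /sin_sum.
by rewrite sumrMnl.
Qed.

(** * Deviation from the mean *)

Definition mean_defect (R : realType) (M N n : nat) (F : nat -> R) : R :=
  \sum_(0 <= k < N) F (M + k)%N - N%:R / n%:R * \sum_(0 <= k < n) F k.

Lemma eq_mean_defect (R : realType) (M N n : nat) (F G : nat -> R) :
  F =1 G -> mean_defect M N n F = mean_defect M N n G.
Proof. by move=> FG; congr (_ - _ * _); apply: eq_bigr. Qed.

Lemma mean_defectD (R : realType) (M N n : nat) (F G : nat -> R) :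
  mean_defect M N n (fun k => F k + G k) = mean_defect M N n F + mean_defect M N n G.
Proof. by rewrite /mean_defect !big_split /=; ring. Qed.

Lemma mean_defectZ (R : realType) (M N n : nat) (c : R) (F : nat -> R) :
  mean_defect M N n (fun k => c * F k) = c * mean_defect M N n F.
Proof. by rewrite /mean_defect -!big_distrr /=; ring. Qed.

Lemma mean_defect_sum (R : realType) (M N n q : nat) (F : nat -> nat -> R) :
  mean_defect M N n (fun k => \sum_(0 <= a < q) F a k) =
  \sum_(0 <= a < q) mean_defect M N n (F a).
Proof.
rewrite /mean_defect exchange_big [X in _ * X]exchange_big /=.
by rewrite big_distrr -sumrB.
Qed.

Lemma sin_mul_sum_cos (R : realType) (z : R) (M N : nat) :
  sin (pi * z) * (\sum_(0 <= k < N) cos (pi * z * (M + k).*2.+1%:R)) *+ 2 =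
  sin (pi * z * (M + N).*2%:R) - sin (pi * z * M.*2%:R).
Proof.
elim: N => [|N IHN]; first by rewrite big_geq // mulr0 mul0rn addn0 subrr.
rewrite big_nat_recr //= mulrDr mulrnDl IHN.
set x := pi * z * (M + N).*2%:R.
have -> : pi * z * (M + N).*2.+1%:R = x + pi * z by rewrite /x -natr1 mulrDr mulr1.
have -> : pi * z * (M + N.+1).*2%:R = x + (pi * z) *+ 2.
  by rewrite /x !natr_double addnS -[(M + N).+1%:R]natr1 -[(pi * z) *+ 2]mulr_natr; ring.
rewrite cosD sinD sin_mulr2n cos_mulr2n cos2sin2; ring.
Qed.

(* When [c / n] is an integer both sides vanish, as [0^-1 = 0]. *)
Lemma mean_defect_cos (R : realType) (M N n h c : nat) : (0 < n)%N ->
  `|mean_defect M N n (fun k => cos (pi * (c%:R / n%:R) * (k + h).*2.+1%:R))|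
  <= csc_norm (c%:R / n%:R : R).
Proof.
move=> n0; have n0R : n%:R != 0 :> R by rewrite pnatr_eq0 -lt0n.
set z : R := c%:R / n%:R.
pose F k := cos (pi * z * (k + h).*2.+1%:R).
have shiftE (m k : nat) : F (m + k)%N = cos (pi * z * (m + h + k).*2.+1%:R).
  by rewrite /F addnAC.
case: (eqVneq (sin (pi * z)) 0) => [sz|sz].
  have F0 k : F k = F 0%N.
    elim: k => [|k <-] //; rewrite /F.
    set x := pi * z * (k + h).*2.+1%:R.
    have -> : pi * z * (k.+1 + h).*2.+1%:R = x + (pi * z) *+ 2.
      rewrite /x !natr_doubleS addSn -[(k + h).+1%:R]natr1.
      by rewrite -[(pi * z) *+ 2]mulr_natr; ring.
    by rewrite cosD sin_mulr2n cos_mulr2n cos2sin2 sz; ring.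
  rewrite /mean_defect (eq_bigr (fun=> F 0%N)) => [|k _]; last exact: F0.
  rewrite [X in _ * X](eq_bigr (fun=> F 0%N)) => [|k _]; last exact: F0.
  rewrite !sumr_const_nat !subn0 -[F 0%N *+ N]mulr_natl -[F 0%N *+ n]mulr_natl.
  rewrite mulrA divfK // subrr normr0.
  by rewrite invr_ge0.
rewrite /mean_defect -/F.
have -> : \sum_(0 <= k < n) cos (pi * z * (k + h).*2.+1%:R) = 0.
  have := sin_mul_sum_cos z h n.
  have -> : pi * z * (h + n).*2%:R = pi * z * h.*2%:R + pi * c.*2%:R.
    by rewrite /z !natr_double natrD; field.
  rewrite sinD cos_2nat_pi sin_nat_pi mulr0 addr0 mulr1 subrr.
  move/eqP; rewrite mulrn_eq0 /= mulf_eq0 (negPf sz) /= => /eqP S0.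
  by rewrite -[RHS]S0; apply: eq_bigr => k _; rewrite [(k + h)%N]addnC.
rewrite mulr0 subr0 /csc_norm -[leRHS]mul1r ler_pdivlMr ?normr_gt0 //.
rewrite -normrM mulrC.
have := sin_mul_sum_cos z (M + h) N.
under [X in _ -> `|_ * X| <= _]eq_bigr => k _ do rewrite addnAC.
set S := sin (pi * z) * _ => SE.
have := sin_max (pi * z * (M + h + N).*2%:R).
have := sin_max (pi * z * (M + h).*2%:R).
move: SE; rewrite -mulr_natr !ler_norml => SE /andP[? ?] /andP[? ?].
by apply/andP; split; lra.
Qed.

(** In the product of the two expansions, $\sin A\sin B$ splits into cosines at the frequencies
    $a/q\pm b/d$, to each of which [mean_defect_cos] applies. *)
Lemma mean_defect_asym (R : realType) (M N h q d : nat) :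
  (0 < q)%N -> (0 < d)%N ->
  `|mean_defect M N (q * d) (fun k => asym R h q k * asym R h d k)| <=
  (2 * (q * d)%:R)^-1 * \sum_(0 <= a < q) \sum_(0 <= b < d)
    `|sin_sum h (a%:R / q%:R : R)| * `|sin_sum h (b%:R / d%:R : R)| *
    (csc_norm ((a * d + b * q)%:R / (q * d)%:R) +
     csc_norm ((a * d + (d - b) * q)%:R / (q * d)%:R)).
Proof.
move=> q0 d0.
have [q0R d0R] : q%:R != 0 :> R /\ d%:R != 0 :> R by rewrite !pnatr_eq0 -!lt0n.
pose ph c k : R := cos (pi * (c%:R / (q * d)%:R) * (k + h).*2.+1%:R).
pose C a b : R := - (2 * (q * d)%:R)^-1 *
  (sin_sum h (a%:R / q%:R) * sin_sum h (b%:R / d%:R)).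
have E k : asym R h q k * asym R h d k = \sum_(0 <= a < q) \sum_(0 <= b < d)
    C a b * (ph (a * d + b * q)%N k + ph (a * d + (d - b) * q)%N k).
  rewrite !asym_fourier // mulrNN mulrACA big_distrlr /= big_distrr /=.
  apply: eq_bigr => a _; rewrite big_distrr /= big_nat [RHS]big_nat.
  apply: eq_bigr => b /= ltb; rewrite /ph /C.
  set X : R := (k + h).*2.+1%:R.
  have -> : pi * ((a * d + b * q)%:R / (q * d)%:R) * X =
      pi * (a%:R / q%:R) * X + pi * (b%:R / d%:R) * X.
    by rewrite natrD !natrM; field; rewrite q0R d0R.
  (* The frequency $a/q-b/d$ is raised by $1$ to remain a quotient of naturals. As [X] is odd, this
     flips the sign of the cosine, so both cosines carry the same coefficient. *)
  have -> : pi * ((a * d + (d - b) * q)%:R / (q * d)%:R) * X =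
      pi * (a%:R / q%:R) * X - pi * (b%:R / d%:R) * X + pi * X.
    by rewrite natrD !natrM natrB 1?ltnW //; field; rewrite q0R d0R.
  rewrite cosD_odd_pi cosD cosB natrM.
  by field; rewrite q0R d0R.
rewrite (eq_mean_defect _ _ _ E) mean_defect_sum big_distrr /=.
apply: (le_trans (ler_norm_sum _ _ _)); apply: ler_sum => a _.
rewrite mean_defect_sum big_distrr /=.
apply: (le_trans (ler_norm_sum _ _ _)); apply: ler_sum => b _.
rewrite mean_defectZ mean_defectD normrM /C normrM normrN [`|_^-1|]ger0_norm; last first.
  by rewrite invr_ge0 mulr_ge0.
rewrite -mulrA ler_wpM2l ?invr_ge0 ?mulr_ge0 // normrM ler_wpM2l ?mulr_ge0 //.
apply: (le_trans (ler_normD _ _)).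
by apply: lerD; apply: mean_defect_cos; rewrite muln_gt0 q0.
Qed.

(** * Harmonic sums and equidistribution of residues *)

Definition hsum (R : realType) (n : nat) : R := \sum_(0 <= i < n) i.+1%:R^-1.

Lemma hsum_ge0 (R : realType) (n : nat) : 0 <= hsum R n.
Proof. by apply: sumr_ge0 => i _; rewrite invr_ge0. Qed.

Lemma le_hsum (R : realType) (m n : nat) : (m <= n)%N -> hsum R m <= hsum R n.
Proof.
move=> lemn; rewrite /hsum (big_cat_nat (n := m) (p := n)) //= lerDl.
by apply: sumr_ge0 => i _; rewrite invr_ge0.
Qed.

Lemma sum_inv_progression (R : realType) (r d q : nat) : (0 < d)%N ->
  \sum_(0 <= j < q) (r + d * j)%:R^-1 <= r%:R^-1 + d%:R^-1 * hsum R q.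
Proof.
move=> d0.
case: q => [|q]; first by rewrite big_geq // addr_ge0 ?mulr_ge0 ?invr_ge0 ?hsum_ge0.
rewrite big_nat_recl //= muln0 addn0 lerD2l.
apply: (@le_trans _ _ (d%:R^-1 * hsum R q)); last first.
  by rewrite ler_wpM2l ?invr_ge0 // le_hsum.
rewrite /hsum big_distrr; apply: ler_sum => j _ /=.
by rewrite -invfM -natrM lef_pV2 ?posrE ?ltr0n ?ler_nat ?leq_addl //; nia.
Qed.

Lemma sum_tau (R : realType) (d : nat) : \sum_(0 <= r < d) tau R d r <= 2 * hsum R d.
Proof.
rewrite big_split /= mulrDl mul1r; apply: lerD.
  case: d => [|d]; first by rewrite big_geq ?hsum_ge0.
  by rewrite big_nat_recl // invr0 add0r le_hsum.
rewrite big_nat_rev /= [leRHS]big_nat big_nat; apply: ler_sum => i /= ltid.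
by have -> : (d - (0 + d - i.+1) = i.+1)%N by lia.
Qed.

(** With $bq=d\lfloor bq/d\rfloor+r$ the frequencies are, modulo $1$, the points $(r+dj)/(qd)$ with
    $0\le j<q$, spaced by $1/q$; the two parts of [tau] yield harmonic sums from either end. *)
Lemma sum_csc_norm (R : realType) (q d b : nat) : (0 < q)%N -> (0 < d)%N ->
  \sum_(0 <= a < q) csc_norm ((a * d + b * q)%:R / (q * d)%:R) <=
  q%:R * (d%:R * tau R d (b * q %% d) + 2 * hsum R q).
Proof.
move=> q0 d0; have n0 : (0 < q * d)%N by rewrite muln_gt0 q0.
set r := (b * q %% d)%N; have ltr : (r < d)%N by rewrite ltn_mod.
pose P j : R := csc_norm ((r + d * j)%:R / (q * d)%:R).
have -> : \sum_(0 <= a < q) csc_norm ((a * d + b * q)%:R / (q * d)%:R) =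
    \sum_(0 <= a < q) P (a + b * q %/ d)%N.
  apply: eq_bigr => a _; congr (csc_norm (_%:R / _)).
  by rewrite {1}(divn_eq (b * q) d) -/r; ring.
rewrite sum_nat_shift_periodic => [|j]; last first.
  rewrite /P /csc_norm norm_sin_modn // [in RHS]norm_sin_modn //.
  by rewrite mulnDr addnA [(d * q)%N]mulnC modnDr.
apply: (@le_trans _ _ (\sum_(0 <= j < q) (q * d)%:R * tau R (q * d) (r + d * j))).
  rewrite big_nat [leRHS]big_nat; apply: ler_sum => j /= ltj.
  by apply: csc_norm_le; nia.
rewrite -big_distrr /= natrM -mulrA ler_wpM2l // /tau big_split /=.
have d0R : 0 < d%:R :> R by rewrite ltr0n.
(* Reversal of [j] turns [q * d - (r + d * j)] into [(d - r) + d * j]. *)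
rewrite [X in _ + X]big_nat_rev /= big_nat [X in _ + X]big_nat.
rewrite [X in _ + X](eq_bigr (fun j => ((d - r) + d * j)%:R^-1)) => [|j /= ltj]; last first.
  by congr (_%:R^-1); nia.
rewrite -!big_nat; have := sum_inv_progression R r q d0.
have := sum_inv_progression R (d - r) q d0.
set A := \sum_(0 <= j < q) _; set B := \sum_(0 <= j < q) _ => leA leB.
apply: (@le_trans _ _ (d%:R * (r%:R^-1 + (d - r)%:R^-1 + 2 * (d%:R^-1 * hsum R q)))).
  rewrite (ler_pM2l d0R); apply: le_trans (lerD leB leA) _.
  by rewrite le_eqVlt; apply/orP; left; apply/eqP; ring.
by rewrite mulrDr [d%:R * (2 * _)]mulrCA mulVKf // lt0r_neq0.
Qed.

(** Over a period, $bq\bmod d$ takes each multiple of $e=\gcd(b,d)$ exactly $e$ times, and this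
    factor cancels because $\tau_d(ei)=\tau_{d/e}(i)/e$. *)
Lemma sum_tau_modn (R : realType) (b d k : nat) : (0 < d)%N ->
  \sum_(0 <= q < d * k) tau R d (b * q %% d) <= k%:R * (2 * hsum R d).
Proof.
move=> d0; rewrite (@sum_nat_mul_periodic _ (fun q => tau R d (b * q %% d)%N)).
  rewrite -[leLHS]mulr_natl ler_wpM2l // sum_nat_mod_gcd //.
  set e := gcdn b d; have ed : (e %| d)%N := dvdn_gcdr b d.
  have e0 : (0 < e)%N := dvdn_gt0 d0 ed.
  have e0R : e%:R != 0 :> R by rewrite pnatr_eq0 -lt0n.
  apply: (@le_trans _ _ (2 * hsum R (d %/ e))); last first.
    by rewrite ler_pM2l // le_hsum // leq_div.
  apply: le_trans (sum_tau R (d %/ e)); rewrite -sumrMnl.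
  apply: ler_sum => i _; rewrite /tau -[leLHS]mulr_natl.
  have -> : (d - e * i = e * (d %/ e - i))%N.
    by rewrite mulnBr [(e * (d %/ e))%N]mulnC divnK.
  by rewrite !natrM !invfM -mulrDr mulrA divff // mul1r.
by move=> q; rewrite mulnDr addnC modnMDl.
Qed.

(** The coefficient at $a/q$ is bounded by $2h$, that at $b/d$ by $2d\tau_d(b)$. Summing over [a]
    leaves [tau] at $bq\bmod d$, whose sum over [q] is controlled by [sum_tau_modn]. *)
Lemma sum_mean_defect_asym (R : realType) (M N h Q d : nat) : (0 < d <= Q)%N ->
  \sum_(1 <= q < Q.+1)
    `|mean_defect M N (q * d) (fun k => asym R h q k * asym R h d k)| <=
  48 * h%:R * Q%:R * hsum R Q ^+ 2.
Proof.
move=> /andP[d0 ledQ]; set H := hsum R Q.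
have H0 : 0 <= H by exact: hsum_ge0.
have d0R : 0 < d%:R :> R by rewrite ltr0n.
pose T q b : R := d%:R * tau R d (b * q %% d).
apply: (@le_trans _ _ (\sum_(1 <= q < Q.+1) 2 * h%:R *
    \sum_(0 <= b < d) tau R d b * (T q b + T q (d - b)%N + 4 * H))).
  rewrite big_nat [leRHS]big_nat; apply: ler_sum => q /andP[q0 ltqQ].
  have q0R : 0 < q%:R :> R by rewrite ltr0n.
  apply: (le_trans (mean_defect_asym _ _ _ _ q0 d0)).
  rewrite exchange_big /= [leLHS]big_distrr [leRHS]big_distrr /= big_nat [leRHS]big_nat.
  apply: ler_sum => b /= ltbd.
  apply: (@le_trans _ _ ((2 * (q * d)%:R)^-1 * (2 * h%:R * (2 * (d%:R * tau R d b)) *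
      (q%:R * (T q b + 2 * hsum R q) + q%:R * (T q (d - b)%N + 2 * hsum R q))))).
    rewrite ler_wpM2l ?invr_ge0 ?mulr_ge0 //.
    apply: (@le_trans _ _ (\sum_(0 <= a < q) 2 * h%:R * (2 * (d%:R * tau R d b)) *
      (csc_norm ((a * d + b * q)%:R / (q * d)%:R) +
       csc_norm ((a * d + (d - b) * q)%:R / (q * d)%:R)))).
      apply: ler_sum => a _; rewrite ler_wpM2r ?addr_ge0 ?invr_ge0 //.
      rewrite ler_pM // ?norm_sin_sum //.
      apply: (le_trans (norm_sin_sum_csc _ _ ltbd)).
      by rewrite ler_pM2l // csc_norm_le.
    rewrite -big_distrr ler_wpM2l ?mulr_ge0 ?tau_ge0 //= big_split /=.
    by apply: lerD; apply: sum_csc_norm.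
  have leH : hsum R q <= H by apply: le_hsum; rewrite -ltnS.
  apply: (@le_trans _ _ (2 * h%:R * tau R d b *
      (T q b + T q (d - b)%N + 4 * hsum R q))).
    rewrite le_eqVlt; apply/orP; left; apply/eqP.
    by rewrite natrM; field; rewrite !lt0r_neq0.
  by rewrite [leRHS]mulrA ler_wpM2l ?mulr_ge0 ?tau_ge0 // lerD2l ler_pM2l.
rewrite -big_distrr exchange_big /=.
(* Here $12=4+4+4$: two sums of [T], and the term $4H$ summed over [q]. *)
apply: (@le_trans _ _ (2 * h%:R * \sum_(0 <= b < d) tau R d b * (12 * Q%:R * H))).
  rewrite ler_wpM2l ?mulr_ge0 //; apply: ler_sum => b _.
  rewrite -big_distrr ler_wpM2l ?tau_ge0 //=.
  have sumT c : \sum_(1 <= q < Q.+1) T q c <= 4 * Q%:R * H.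
    (* The range of [q] is enlarged to a multiple of [d]; since $d\le Q$, its length is at most
       $2Q$. *)
    apply: (@le_trans _ _ (\sum_(0 <= q < d * (Q %/ d).+1) T q c)).
      have ltQ : (Q.+1 <= d * (Q %/ d).+1)%N.
        by rewrite {1}(divn_eq Q d) mulnS [(d * _)%N]mulnC addnC ltn_add2r ltn_mod.
      rewrite [leRHS](@big_cat_nat _ _ _ Q.+1) //= [X in _ <= X + _]big_ltn //.
      rewrite -addrA [leRHS]addrC -addrA lerDl addr_ge0 //.
        by apply: sumr_ge0 => q _; rewrite mulr_ge0 ?tau_ge0.
      by rewrite mulr_ge0 ?tau_ge0.
    rewrite -big_distrr /=.
    apply: (@le_trans _ _ (d%:R * ((Q %/ d).+1%:R * (2 * hsum R d)))).
      by rewrite ler_pM2l // sum_tau_modn.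
    rewrite mulrA -natrM.
    apply: (@le_trans _ _ ((2 * Q)%:R * (2 * H))).
      rewrite ler_pM ?mulr_ge0 ?hsum_ge0 ?ler_nat ?ler_pM2l ?le_hsum //.
      by have := leq_divM Q d; rewrite mulnS mulnC; lia.
    by rewrite natrM; lra.
  rewrite !big_split /= sumr_const_nat subn1 /= -mulr_natl.
  have := sumT b; have := sumT (d - b)%N; lra.
rewrite -big_distrl /=.
apply: (@le_trans _ _ (2 * h%:R * (2 * H * (12 * Q%:R * H)))).
  rewrite ler_wpM2l ?mulr_ge0 // ler_wpM2r ?mulr_ge0 //.
  by apply: (le_trans (sum_tau R d)); rewrite ler_pM2l // le_hsum.
by rewrite le_eqVlt; apply/orP; left; apply/eqP; ring.
Qed.

(** * The symmetry integral as a finite sum *)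

Lemma integrableU d (T : measurableType d) (R : realType)
    (mu : {measure set T -> \bar R}) (A B : set T) (f : T -> R) :
  measurable A -> measurable B -> [disjoint A & B] ->
  mu.-integrable A (EFin \o f) -> mu.-integrable B (EFin \o f) ->
  mu.-integrable (A `|` B) (EFin \o f).
Proof.
move=> mA mB AB /integrableP[mfA ifA] /integrableP[mfB ifB].
have mf : measurable_fun (A `|` B) (EFin \o f).
  apply/measurable_EFinP/measurable_funU => //.
  by split; apply/measurable_EFinP.
apply/integrableP; split=> //.
rewrite ge0_integral_setU //; first exact: lte_add_pinfty.
exact: measurableT_comp.
Qed.

Lemma integrable_cst_itvoo (R : realType) (a b r : R) :
  lebesgue_measure.-integrable `]a, b[%classic (EFin \o (fun=> r)).
Proof.
apply/integrableP; split; first exact: measurable_cst.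
rewrite (_ : (fun x => _) = cst `|r%:E|%E) // integral_cst //.
apply: lte_mul_pinfty => //.
have : (lebesgue_measure (`]a, b[%classic : set R) < +oo)%E.
  by rewrite lebesgue_measure_itv /=; case: ifP => _; rewrite ?ltry // -EFinB ltry.
by [].
Qed.

Lemma Rintegral_step (R : realType) (f : R -> R) (c : nat -> R) (N m : nat) :
  (forall k x, (k < m)%N -> (N + k)%:R < x < (N + k).+1%:R -> f x = c k) ->
  \int[lebesgue_measure]_(x in `[N%:R, (N + m)%:R]) f x = \sum_(0 <= k < m) c k.
Proof.
move=> fc; pose mu := @lebesgue_measure R.
(* Half-open intervals make the unit pieces disjoint, and integrability is carried through the
   induction because additivity of the integral needs it. *)
suff [ifm <-] : mu.-integrable `[N%:R, (N + m)%:R[%classic (EFin \o f) /\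
    \int[mu]_(x in `[N%:R, (N + m)%:R[) f x = \sum_(0 <= k < m) c k.
  by rewrite Rintegral_itv_bndo_bndc.
elim: m fc => [|m IHm] fc.
  rewrite addn0 set_itvco0 Rintegral_set0 big_geq //; split=> //.
  exact: integrable_set0.
have [ifm Im] := IHm (fun k x ltk => fc k x (ltnW ltk)).
set a : R := (N + m)%:R; set b : R := (N + m.+1)%:R.
have ltab : a < b by rewrite /a /b ltr_nat addnS.
have fab x : x \in `]a, b[%classic -> f x = c m.
  rewrite inE /= in_itv /= => xab; apply: fc => //.
  by rewrite -addnS.
have ioo : mu.-integrable `]a, b[%classic (EFin \o f).
  apply: eq_integrable (integrable_cst_itvoo a b (c m)) => //.
  by move=> x /fab /= ->.
have ico : mu.-integrable `[a, b[%classic (EFin \o f).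
  rewrite -(@setU1itv _ _ (BLeft b) a false) ?bnd_simp //; apply: integrableU => //.
  - by apply/disj_setPS => x [/= ->]; rewrite in_itv /= ltxx.
  - apply/integrableP; split; first exact: measurable_fun_set1.
    by rewrite integral_set1.
have E : `[N%:R, b[%classic = `[N%:R, a[%classic `|` `[a, b[%classic :> set R.
  apply: itv_bndbnd_setU; rewrite bnd_simp; last exact: ltW.
  by rewrite /a ler_nat leq_addr.
have dis : [disjoint `[N%:R, a[%classic & `[a, b[%classic].
  apply/disj_setPS => x [/=]; rewrite !in_itv /= => /andP[_ xa] /andP[ax _].
  by move: xa; rewrite ltNge ax.
split; first by rewrite E; apply: integrableU.
rewrite E Rintegral_setU //; last by apply: integrableU.
rewrite big_nat_recr //= Im; congr (_ + _).
rewrite -Rintegral_itv_obnd_cbnd // (@eq_Rintegral _ _ _ mu _ (fun=> c m)) //.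
rewrite Rintegral_cst //.
have mE : lebesgue_measure (`]a, b[%classic : set R) = (b - a)%:E.
  by rewrite lebesgue_measure_itv /= lte_fin ltab -EFinB.
rewrite (_ : fine _ = b - a); last by rewrite -[RHS]/(fine (b - a)%:E) -mE.
by rewrite /a /b -natrB ?leq_add2l // subnDl subSnn mulr1.
Qed.

(** The integers within [h] of such an [x] are [k + 1, ..., k + 2 * h], and those above [k + h] lie
    to the right of [x]. *)
Lemma symmetry_sumE (R : realType) (F : nat -> R) (h k : nat) (x : R) :
  (k + h)%:R < x < (k + h).+1%:R ->
  symmetry_sum F h x = \sum_(0 <= i < h) (F (k + h + 1 + i)%N - F (k + 1 + i)%N).
Proof.
move=> /andP[ltx xlt]; rewrite -natr1 in xlt.
rewrite /symmetry_sum (@fsbigE _ _ _ _ _ (index_iota k.+1 (k + h + h).+1)).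
- rewrite big_seq_cond; under eq_bigl => n.
    rewrite andb_idr; last first.
      rewrite mem_index_iota => /andP[n1 n2]; rewrite inE /=; split; first by lia.
      have n1R : k%:R + 1 <= n%:R :> R by rewrite natr1 ler_nat.
      have n2R : n%:R <= k%:R + h%:R + h%:R :> R by rewrite -!natrD ler_nat.
      rewrite natrD in ltx xlt.
      by rewrite ler_norml; apply/andP; split; lra.
    over.
  rewrite -big_seq /= (@big_cat_nat _ _ _ (k + h).+1) /=; try lia.
  rewrite addrC sumrB; congr (_ + _).
    rewrite -{1}[(k + h).+1]add0n big_addn subSS addKn big_nat [RHS]big_nat.
    apply: eq_bigr => i /= ltih; rewrite gtr0_sg ?mul1r; last first.
      rewrite subr_gt0; apply: (lt_le_trans xlt).
      by rewrite natr1 ler_nat; lia.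
    by congr F; lia.
  rewrite -sumrN -{1}[k.+1]add0n big_addn.
  have -> : ((k + h).+1 - k.+1 = h)%N by lia.
  rewrite big_nat [RHS]big_nat.
  apply: eq_bigr => i /= ltih; rewrite ltr0_sg ?mulN1r; last first.
    rewrite subr_lt0; apply: le_lt_trans ltx.
    by rewrite ler_nat; lia.
  by congr (- F _); lia.
- exact: iota_uniq.
- move=> n /=; rewrite mem_index_iota => /andP[n1 n2]; split; first by lia.
  have n1R : k%:R + 1 <= n%:R :> R by rewrite natr1 ler_nat.
  have n2R : n%:R <= k%:R + h%:R + h%:R :> R by rewrite -!natrD ler_nat.
  rewrite natrD in ltx xlt.
  by rewrite ler_norml; apply/andP; split; lra.
- move=> n /= [n0]; rewrite ler_norml => /andP[lo hi] /negP[].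
  rewrite natrD in ltx xlt.
  rewrite mem_index_iota -!(ltr_nat R) -[(k + h + h).+1%:R]natr1 !natrD.
  by apply/andP; split; lra.
Qed.

Lemma conv_oneE (R : realType) (g : nat -> R) (n Q : nat) : (0 < n)%N ->
  (forall q, (Q < q)%N -> g q = 0) ->
  conv_one g n = \sum_(1 <= q < Q.+1) g q * (q %| n)%N%:R.
Proof.
move=> n0 g0; rewrite /conv_one /dirichlet_conv.
under eq_bigr do rewrite mulr1.
rewrite (@big_divisors _ _ _ (n + Q).+1); last by rewrite n0; lia.
rewrite (@big_cat_nat _ _ _ Q.+1) //=; last by lia.
rewrite [X in _ + X]big_nat [X in _ + X]big1 => [|q /andP[ltQ _]]; last first.
  by rewrite g0 //; case: ifP.
rewrite addr0 big_ltn // dvd0n (gtn_eqF n0) add0r.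
by apply: eq_bigr => q _; case: ifP; rewrite ?mulr1 ?mulr0.
Qed.

Lemma symmetry_sum_conv_one (R : realType) (g : nat -> R) (Q h k : nat) (x : R) :
  (forall q, (Q < q)%N -> g q = 0) -> (k + h)%:R < x < (k + h).+1%:R ->
  symmetry_sum (conv_one g) h x = \sum_(1 <= q < Q.+1) g q * asym R h q k.
Proof.
move=> g0 /symmetry_sumE ->.
under eq_bigr => i _.
  rewrite !(@conv_oneE _ _ _ Q) //; try by rewrite addn1 addSn.
  rewrite -sumrB; under eq_bigr do rewrite -mulrBr.
  over.
rewrite exchange_big /=; apply: eq_bigr => q _.
by rewrite -big_distrr.
Qed.

Lemma symmetry_integral_conv_one (R : realType) (g g1 : nat -> R) (Q D N h : nat) :
  (h <= N)%N -> (forall q, (Q < q)%N -> g q = 0) -> (forall d, (D < d)%N -> g1 d = 0) ->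
  symmetry_integral (conv_one g) (conv_one g1) N h =
  \sum_(1 <= d < D.+1) \sum_(1 <= q < Q.+1) g q * g1 d *
    \sum_(0 <= k < N) asym R h q (N - h + k) * asym R h d (N - h + k).
Proof.
move=> lehN g0 g10; rewrite /symmetry_integral.
have -> : 2 * N%:R = (N + N)%:R :> R by rewrite natrD; ring.
rewrite (@Rintegral_step _ _ (fun k =>
    (\sum_(1 <= q < Q.+1) g q * asym R h q (N - h + k)) *
    (\sum_(1 <= d < D.+1) g1 d * asym R h d (N - h + k)))) => [|k x _ xk]; last first.
  (* This is where $h\le N$ enters: the argument of [asym] lags the integer part of [x] by [h]. *)
  have E : (N + k = N - h + k + h)%N by lia.
  by rewrite E in xk; rewrite (symmetry_sum_conv_one g0 xk) (symmetry_sum_conv_one g10 xk).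
under eq_bigr => k _ do rewrite mulrC big_distrlr /=.
rewrite exchange_big /=; apply: eq_bigr => d _.
rewrite exchange_big /=; apply: eq_bigr => q _.
rewrite big_distrr; apply: eq_bigr => k _ /=; ring.
Qed.

(** * Main term and error for fixed [N] *)

(** For [g] vanishing beyond [Q] this is the Ramanujan coefficient of [conv_one g], as a finite
    sum. *)
Definition rsum (R : realType) (g : nat -> R) (Q l : nat) : R :=
  \sum_(1 <= m < Q.+1 | (l %| m)%N) g m / m%:R.

Lemma rsumE (R : realType) (g : nat -> R) (Q l : nat) :
  rsum g Q l = \sum_(1 <= m < Q.+1) (l %| m)%N%:R * (g m / m%:R).
Proof.
rewrite /rsum big_mkcond; apply: eq_bigr => m _.
by case: ifP; rewrite ?mul1r ?mul0r.
Qed.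

(** As $\Vert h\Vert=0$, the term $\ell=1$ is zero, so the main term over $\ell>1$ is a full divisor
    sum. *)
Lemma moebius_dist_sum1 (R : realType) (h : nat) : moebius_dist_sum R h 1 = 0.
Proof.
have := @moebius_dist_sumE R h 1 isT; rewrite expr1n mul1r => ->.
by rewrite /dirichlet_conv big_seq1 /sym_energy modn1 min0n muln0 mulr0.
Qed.

(** After expansion of both coefficients, $\ell$ runs over the common divisors of [q] and [d], and
    the weights add up to the energy at the gcd. Up to a factor $2$ the result is the weighted sum
    of the means of $X_qX_d$. *)
Lemma sum_rsum (R : realType) (g g1 : nat -> R) (Q D h : nat) :
  \sum_(2 <= l < D.+1) l%:R ^+ 2 * rsum g Q l * rsum g1 D l * moebius_dist_sum R h l =
  \sum_(1 <= d < D.+1) \sum_(1 <= q < Q.+1)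
    g q * g1 d * ((sym_energy h (gcdn q d))%:R / (q * d)%:R).
Proof.
pose k l : R := l%:R ^+ 2 * moebius_dist_sum R h l.
transitivity (\sum_(0 <= l < D.+1) k l * (rsum g Q l * rsum g1 D l)).
  rewrite [RHS]big_ltn // [k 0%N]/k expr0n !mul0r add0r.
  case: D => [|D]; first by rewrite !big_geq.
  rewrite [RHS]big_ltn // [k 1%N]/k moebius_dist_sum1 mulr0 mul0r add0r.
  by apply: eq_bigr => l _; rewrite /k; ring.
transitivity (\sum_(0 <= l < D.+1) \sum_(1 <= d < D.+1) \sum_(1 <= q < Q.+1)
    k l * ((l %| q)%N%:R * (g q / q%:R) * ((l %| d)%N%:R * (g1 d / d%:R)))).
  apply: eq_bigr => l _; rewrite [rsum _ _ _ * _]mulrC !rsumE.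
  rewrite big_distrlr /= mulr_sumr; apply: eq_bigr => d _.
  by rewrite mulr_sumr; apply: eq_bigr => q _; ring.
rewrite exchange_big big_nat [RHS]big_nat; apply: eq_bigr => d /andP[d0 ltd] /=.
rewrite exchange_big big_nat [RHS]big_nat; apply: eq_bigr => q /andP[q0 ltq] /=.
have gd : (0 < gcdn q d < D.+1)%N.
  rewrite gcdn_gt0 q0 /=; apply: leq_ltn_trans ltd.
  exact: dvdn_leq (dvdn_gcdr _ _).
rewrite -(sum_moebius_dist_sum R h gd) mulr_suml mulr_sumr; apply: eq_bigr => l _.
rewrite dvdn_gcd natrM invfM -/(k l).
by case: (l %| q)%N; case: (l %| d)%N; rewrite /= ?mul0r ?mulr0 // ?mul0r ?mulr0 //; ring.
Qed.

(** The main term is subtracted pair by pair: by [sum_asym_mulE] its share in each pair is [N] times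
    the mean over a period [q * d]. *)
Lemma symmetry_integral_defect (R : realType) (g g1 : nat -> R) (Q D N h : nat) :
  (h <= N)%N -> (forall q, (Q < q)%N -> g q = 0) -> (forall d, (D < d)%N -> g1 d = 0) ->
  symmetry_integral (conv_one g) (conv_one g1) N h -
    2 * N%:R * \sum_(2 <= l < D.+1)
      l%:R ^+ 2 * rsum g Q l * rsum g1 D l * moebius_dist_sum R h l =
  \sum_(1 <= d < D.+1) \sum_(1 <= q < Q.+1) g q * g1 d *
    mean_defect (N - h) N (q * d) (fun k => asym R h q k * asym R h d k).
Proof.
move=> lehN g0 g10; rewrite (symmetry_integral_conv_one lehN g0 g10) sum_rsum.
rewrite mulr_sumr -sumrB big_nat [RHS]big_nat; apply: eq_bigr => d /andP[d0 _].
rewrite mulr_sumr -sumrB big_nat [RHS]big_nat; apply: eq_bigr => q /andP[q0 _].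
by rewrite /mean_defect sum_asym_mulE // natrM; ring.
Qed.

Lemma symmetry_integral_error (R : realType) (g g1 : nat -> R) (Q D N h : nat)
    (b b1 : R) :
  (h <= N)%N -> (D <= Q)%N ->
  (forall q, (Q < q)%N -> g q = 0) -> (forall d, (D < d)%N -> g1 d = 0) ->
  (forall q, (0 < q)%N -> `|g q| <= b) -> (forall d, (0 < d)%N -> `|g1 d| <= b1) ->
  `|symmetry_integral (conv_one g) (conv_one g1) N h -
    2 * N%:R * \sum_(2 <= l < D.+1)
      l%:R ^+ 2 * rsum g Q l * rsum g1 D l * moebius_dist_sum R h l| <=
  b * b1 * (D%:R * (48 * h%:R * Q%:R * hsum R Q ^+ 2)).
Proof.
move=> lehN leDQ g0 g10 gb g1b; rewrite symmetry_integral_defect //.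
have b0 : 0 <= b by apply: le_trans (normr_ge0 _) (gb 1%N isT).
have b10 : 0 <= b1 by apply: le_trans (normr_ge0 _) (g1b 1%N isT).
apply: (le_trans (ler_norm_sum _ _ _)).
apply: (@le_trans _ _ (\sum_(1 <= d < D.+1)
    b * b1 * (48 * h%:R * Q%:R * hsum R Q ^+ 2))); last first.
  by rewrite sumr_const_nat subn1 /= -mulr_natl; lra.
rewrite big_nat [leRHS]big_nat; apply: ler_sum => d /andP[d0 ltd].
apply: (le_trans (ler_norm_sum _ _ _)).
have dQ : (0 < d <= Q)%N by rewrite d0 (leq_trans _ leDQ).
apply: le_trans (ler_wpM2l (mulr_ge0 b0 b10) (sum_mean_defect_asym R (N - h) N h dQ)).
rewrite mulr_sumr big_nat [leRHS]big_nat; apply: ler_sum => q /andP[q0 _].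
by rewrite normrM ler_wpM2r // normrM ler_pM // ?gb ?g1b.
Qed.

(** * Lower bounds for the main term *)

Lemma rsum_ge0 (R : realType) (g : nat -> R) (Q l : nat) :
  (forall q, (1 <= q <= Q)%N -> 0 <= g q) -> 0 <= rsum g Q l.
Proof.
move=> g0; rewrite rsumE big_nat sumr_ge0 // => m /g0 gm.
by rewrite mulr_ge0 ?divr_ge0.
Qed.

Lemma le_rsum (R : realType) (g1 g : nat -> R) (D Q l : nat) : (D <= Q)%N ->
  (forall q, (1 <= q <= D)%N -> g1 q <= g q) ->
  (forall q, (1 <= q <= Q)%N -> 0 <= g q) -> rsum g1 D l <= rsum g Q l.
Proof.
move=> leDQ le_g g0; rewrite !rsumE [leRHS](@big_cat_nat _ _ _ D.+1) //=.
rewrite -[leLHS]addr0 lerD //.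
  rewrite big_nat [leRHS]big_nat; apply: ler_sum => m /le_g leg.
  by rewrite ler_wpM2l // ler_wpM2r ?invr_ge0.
rewrite big_nat sumr_ge0 // => m /andP[m1 m2].
by rewrite mulr_ge0 ?divr_ge0 ?g0 //; lia.
Qed.

(* Only the diagonal terms [q = d] with [2 h <= d < 4 h] are kept: there
   [sym_energy h d / d ^ 2 = h / d]. *)
Lemma main_term_ge (R : realType) (g g1 : nat -> R) (Q D h : nat) :
  (4 * h <= D <= Q)%N ->
  (forall q, (1 <= q <= Q)%N -> 1 <= g q) -> (forall d, (1 <= d <= D)%N -> 1 <= g1 d) ->
  h%:R / 2 <= \sum_(2 <= l < D.+1)
    l%:R ^+ 2 * rsum g Q l * rsum g1 D l * moebius_dist_sum R h l.
Proof.
move=> /andP[le4h leDQ] g_ge1 g1_ge1; pose one (n : nat) : R := 1.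
(* All weights being nonnegative, [g] and [g1] may be lowered to the constant $1$ on $[1,D]$. *)
apply: (@le_trans _ _ (\sum_(2 <= l < D.+1)
    l%:R ^+ 2 * rsum one D l * rsum one D l * moebius_dist_sum R h l)); last first.
  rewrite big_nat [leRHS]big_nat; apply: ler_sum => l /andP[l2 _].
  rewrite ler_wpM2r ?moebius_dist_sum_ge0 //; first by lia.
  have one0 : 0 <= rsum one D l by apply: rsum_ge0 => *; exact: ler01.
  rewrite ler_pM ?mulr_ge0 ?exprn_ge0 //.
    rewrite ler_wpM2l ?exprn_ge0 //; apply: le_rsum => // q q1.
      by apply: g_ge1; lia.
    by apply: le_trans (g_ge1 _ q1).
  by apply: le_rsum => // d d1; apply: le_trans (g1_ge1 _ d1).
rewrite sum_rsum.
have term0 q d : 0 <= one q * one d * ((sym_energy h (gcdn q d))%:R / (q * d)%:R).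
  by rewrite /one !mul1r divr_ge0.
apply: (@le_trans _ _ (\sum_(1 <= d < D.+1) (sym_energy h d)%:R / (d * d)%:R)); last first.
  rewrite big_nat [leRHS]big_nat; apply: ler_sum => d /andP[d0 ltd].
  rewrite (bigD1_seq d) ?iota_uniq ?mem_index_iota ?d0 //= gcdnn /one !mul1r lerDl.
  by apply: sumr_ge0 => q _; rewrite mul1r divr_ge0.
case: (posnP h) => [->|h0]; first by rewrite mul0r sumr_ge0 // => d _; rewrite divr_ge0.
rewrite (@big_cat_nat _ _ _ (2 * h)) /=; try lia.
rewrite [X in _ <= _ + X](@big_cat_nat _ _ _ (4 * h)) /=; try lia.
have nn (a b : nat) : 0 <= \sum_(a <= d < b) ((sym_energy h d)%:R / (d * d)%:R : R).
  by apply: sumr_ge0 => d _; rewrite divr_ge0.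
(* On this range $h/d\ge1/4$, and there are $2h$ terms. *)
apply: (@le_trans _ _ (\sum_(2 * h <= d < 4 * h) (4^-1 : R))).
  rewrite sumr_const_nat -[leRHS]mulr_natr.
  have -> : (4 * h - 2 * h = 2 * h)%N by lia.
  by rewrite natrM; lra.
apply: (@le_trans _ _ (\sum_(2 * h <= d < 4 * h) ((sym_energy h d)%:R / (d * d)%:R))).
  rewrite big_nat [leRHS]big_nat; apply: ler_sum => d /andP[d1 d2].
  have -> : sym_energy h d = (d * h)%N.
    by rewrite /sym_energy modn_small; [congr (_ * _)%N; lia|lia].
  have d0 : 0 < d%:R :> R by rewrite ltr0n; lia.
  rewrite !natrM -mulf_div divff ?lt0r_neq0 // mul1r ler_pdivlMr // ler_pdivrMl //.
  by rewrite -natrM ler_nat ltnW.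
by rewrite addrCA lerDl addr_ge0.
Qed.

Lemma mulr_rsum (R : realType) (g : nat -> R) (Q l : nat) : (0 < l)%N ->
  l%:R * rsum g Q l = \sum_(1 <= q < (Q %/ l).+1) g (l * q)%N / q%:R.
Proof.
move=> l0; have l0R : l%:R != 0 :> R by rewrite pnatr_eq0 -lt0n.
pose F m : R := (l %| m)%N%:R * (g m / m%:R).
have F0 : F 0%N = 0 by rewrite /F invr0 !mulr0.
have -> : rsum g Q l = \sum_(0 <= m < Q.+1) F m.
  by rewrite rsumE [RHS]big_ltn // F0 add0r.
(* The range is rounded up to a multiple of [l]; the added indices include no multiple of [l]. *)
have -> : \sum_(0 <= m < Q.+1) F m = \sum_(0 <= m < l * (Q %/ l).+1) F m.
  have ltQ : (Q.+1 <= l * (Q %/ l).+1)%N.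
    by rewrite {1}(divn_eq Q l) mulnS [(l * _)%N]mulnC addnC ltn_add2r ltn_mod.
  rewrite [RHS](@big_cat_nat _ _ _ Q.+1) //= [X in _ + X]big_nat.
  rewrite [X in _ + X]big1 ?addr0 // => m /andP[ltQm ltm].
  rewrite /F; case: (boolP (l %| m)%N) => [/dvdnP[j mE]|]; last by rewrite mul0r.
  have : (j < (Q %/ l).+1)%N by rewrite -(ltn_pmul2l l0) [(l * j)%N]mulnC -mE.
  rewrite ltnS => /(leq_mul (leqnn l)); have := leq_divM Q l; lia.
rewrite sum_nat_mul [\sum_(0 <= r < l) _]big_ltn // [X in _ + X]big_nat.
rewrite [X in _ + X]big1 ?addr0 => [|r /andP[r0 ltr]]; last first.
  apply: big1 => k _; rewrite /F dvdn_addl ?dvdn_mulr // gtnNdvd //.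
  by rewrite mul0r.
rewrite big_ltn // muln0 add0n F0 add0r mulr_sumr big_nat [RHS]big_nat.
apply: eq_bigr => q /andP[q0 _].
rewrite /F add0n dvdn_mulr // mul1r natrM.
by field; rewrite l0R pnatr_eq0 -lt0n q0.
Qed.

(** One factor of $\ell^2$ goes to each coefficient by [mulr_rsum]; the terms with $\ell>D/2$ are
    nonnegative and are dropped. *)
Lemma le_main_term (R : realType) (g g1 : nat -> R) (Q D h : nat) :
  (forall q, (1 <= q <= Q)%N -> 0 <= g q) -> (forall d, (1 <= d <= D)%N -> 0 <= g1 d) ->
  \sum_(2 <= l < (D %/ 2).+1)
    (\sum_(1 <= d < (D %/ l).+1) g1 (l * d)%N / d%:R) *
    (\sum_(1 <= q < (Q %/ l).+1) g (l * q)%N / q%:R) * moebius_dist_sum R h l <=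
  \sum_(2 <= l < D.+1)
    l%:R ^+ 2 * rsum g Q l * rsum g1 D l * moebius_dist_sum R h l.
Proof.
move=> g0 g10.
have term0 l : (2 <= l)%N ->
    0 <= l%:R ^+ 2 * rsum g Q l * rsum g1 D l * moebius_dist_sum R h l.
  move=> l2; rewrite !mulr_ge0 ?exprn_ge0 ?rsum_ge0 // moebius_dist_sum_ge0 //.
  by lia.
apply: (@le_trans _ _ (\sum_(2 <= l < (D %/ 2).+1)
    l%:R ^+ 2 * rsum g Q l * rsum g1 D l * moebius_dist_sum R h l)).
  rewrite le_eqVlt; apply/orP; left; apply/eqP.
  rewrite big_nat [RHS]big_nat; apply: eq_bigr => l /andP[l2 _].
  by rewrite -!mulr_rsum; [ring|lia|lia].
case: (ltnP (D %/ 2) 1) => [D2|D2].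
  rewrite big_geq; last by lia.
  by rewrite big_nat sumr_ge0 // => l /andP[l2 _]; exact: term0.
rewrite [leRHS](@big_cat_nat _ _ _ (D %/ 2).+1) //=; last by rewrite ltnS leq_div.
rewrite lerDl big_nat sumr_ge0 // => l /andP[l2 _]; apply: term0; lia.
Qed.

(* The error is absorbed because the main term is at least [N h]. *)
Lemma symmetry_integral_ge (R : realType) (g g1 : nat -> R) (Q D N h : nat) :
  (4 * h <= D <= Q)%N ->
  (forall q, (1 <= q <= Q)%N -> 1 <= g q) -> (forall d, (1 <= d <= D)%N -> 1 <= g1 d) ->
  `|symmetry_integral (conv_one g) (conv_one g1) N h -
    2 * N%:R * \sum_(2 <= l < D.+1)
      l%:R ^+ 2 * rsum g Q l * rsum g1 D l * moebius_dist_sum R h l| <=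
    2^-1 * (N%:R * h%:R) ->
  N%:R * \sum_(2 <= l < (D %/ 2).+1)
    (\sum_(1 <= d < (D %/ l).+1) g1 (l * d)%N / d%:R) *
    (\sum_(1 <= q < (Q %/ l).+1) g (l * q)%N / q%:R) * moebius_dist_sum R h l <=
  symmetry_integral (conv_one g) (conv_one g1) N h.
Proof.
move=> hDQ g_ge1 g1_ge1; have := main_term_ge hDQ g_ge1 g1_ge1.
set S := \sum_(2 <= l < D.+1) _ => hS; rewrite ler_norml => /andP[lo _].
have NhS : N%:R * (h%:R / 2) <= N%:R * S by rewrite ler_wpM2l.
apply: (@le_trans _ _ (N%:R * S)); last by lra.
by rewrite ler_wpM2l // le_main_term // => n n1;
  [apply: le_trans (g_ge1 _ n1)|apply: le_trans (g1_ge1 _ n1)].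
Qed.

(** Since $\ell\le D$, the sum over $q\le Q/\ell$ may be shortened to $q\le Q/D$, where monotonicity
    under dilation removes $\ell$ from the argument of [g]. *)
Lemma le_sum_dilate (R : realType) (g g1 : nat -> R) (Q D h : nat) :
  (forall q, (1 <= q <= Q)%N -> 0 <= g q) -> (forall d, (1 <= d <= D)%N -> 0 <= g1 d) ->
  (forall l q, (1 <= l <= Q)%N -> (1 <= q <= Q %/ l)%N -> g q <= g (l * q)%N) ->
  (D <= Q)%N ->
  (\sum_(1 <= q < (Q %/ D).+1) g q / q%:R) *
    \sum_(2 <= l < (D %/ 2).+1)
      (\sum_(1 <= d < (D %/ l).+1) g1 (l * d)%N / d%:R) * moebius_dist_sum R h l <=
  \sum_(2 <= l < (D %/ 2).+1)
    (\sum_(1 <= d < (D %/ l).+1) g1 (l * d)%N / d%:R) *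
    (\sum_(1 <= q < (Q %/ l).+1) g (l * q)%N / q%:R) * moebius_dist_sum R h l.
Proof.
move=> g0 g10 gl leDQ; rewrite mulr_sumr big_nat [leRHS]big_nat.
apply: ler_sum => l /andP[l2 ltl].
have leD : (l <= D)%N by apply: leq_trans (leq_div D 2); lia.
rewrite mulrA ler_wpM2r ?moebius_dist_sum_ge0 //; first by lia.
rewrite mulrC ler_wpM2l //.
  by rewrite -mulr_rsum; [rewrite mulr_ge0 ?rsum_ge0|lia].
have leQ : (Q %/ D <= Q %/ l)%N by rewrite leq_div2l //; lia.
rewrite [leRHS](@big_cat_nat _ _ _ (Q %/ D).+1) //= -[leLHS]addr0 lerD //.
  rewrite big_nat [leRHS]big_nat; apply: ler_sum => q /andP[q1 ltq].
  by rewrite ler_wpM2r ?invr_ge0 // gl //; lia.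
rewrite big_nat sumr_ge0 // => q /andP[q1 ltq]; rewrite divr_ge0 // g0 //.
have := leq_divM Q l; have : (q <= Q %/ l)%N by [].
by move=> /(leq_mul (leqnn l)); nia.
Qed.

(** * Asymptotics *)

(** The inductive step is $\ln(x/(x+1))\le-1/(x+1)$. *)
Lemma hsum_le_ln (R : realType) (n : nat) : hsum R n.+1 <= 1 + ln n.+1%:R.
Proof.
elim: n => [|n IHn]; first by rewrite /hsum big_nat1 invr1 ln1 addr0.
rewrite /hsum big_nat_recr //= -/(hsum R n.+1).
set x : R := n.+1%:R; have x0 : 0 < x by rewrite ltr0n.
have yE : n.+2%:R = x + 1 :> R by rewrite natr1.
rewrite yE.
have : ln (1 + - (x + 1)^-1) <= - (x + 1)^-1 :> R.
  by apply: le_ln1Dx; rewrite ltrN2 invf_lt1 ?ltrDr ?addr_gt0.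
have xn0 : x + 1 != 0 by rewrite lt0r_neq0 // addr_gt0.
have -> : 1 + - (x + 1)^-1 = x / (x + 1) by field.
rewrite ln_div ?posrE ?addr_gt0 // => ?.
by move: IHn; rewrite -/x; lra.
Qed.

(** From $\ln x=e^{-1}\ln x^e\le e^{-1}x^e$ and $1\le x^e$. *)
Lemma hsum_le_powR (R : realType) (e : R) (n : nat) : 0 < e ->
  hsum R n <= (1 + e^-1) * n%:R `^ e.
Proof.
move=> e0; case: n => [|n].
  by rewrite /hsum big_geq // mulr_ge0 ?powR_ge0 // addr_ge0 // invr_ge0 ltW.
apply: le_trans (hsum_le_ln R n) _; set x : R := n.+1%:R.
have x1 : 1 <= x by rewrite ler1n.
have xe1 : 1 <= x `^ e by rewrite -(powRr0 x) ler_powR // ltW.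
rewrite mulrDl mul1r lerD // ler_pdivlMl // -ln_powR.
by apply/ltW/ln_sublinear; rewrite powR_gt0 // (lt_le_trans ltr01).
Qed.

Lemma near_powR_ge (R : realType) (A e : R) : 0 < e ->
  \forall N \near \oo, A <= N%:R `^ e.
Proof.
move=> e0; near=> N.
have ltAN : A `^ e^-1 < N%:R by near: N; exact: nbhs_infty_gtr.
have [A0|A0] := leP A 0; first by apply: le_trans A0 (powR_ge0 _ _).
have -> : A = (A `^ e^-1) `^ e by rewrite -powRrM mulVf ?lt0r_neq0 // powRr1 // ltW.
by apply: ge0_ler_powR; rewrite ?nnegrE ?powR_ge0 //; exact: ltW.
Unshelve. all: by end_near. Qed.

Lemma floor_pow_le (R : realType) (a : R) (N : nat) : (floor_pow a N)%:R <= N%:R `^ a.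
Proof. by rewrite /floor_pow truncn_le powR_ge0. Qed.

Lemma floor_pow_ge (R : realType) (a : R) (N n : nat) :
  n%:R <= N%:R `^ a -> (n <= floor_pow a N)%N.
Proof. by rewrite /floor_pow truncn_ge_nat ?powR_ge0. Qed.

Lemma le_floor_pow (R : realType) (a b : R) (N : nat) : (0 < N)%N -> a <= b ->
  (floor_pow a N <= floor_pow b N)%N.
Proof.
move=> N0 leab; apply: floor_pow_ge; apply: le_trans (floor_pow_le _ _) _.
by rewrite ler_powR // ler1n.
Qed.

Lemma floor_pow_leN (R : realType) (a : R) (N : nat) : (0 < N)%N -> a <= 1 ->
  (floor_pow a N <= N)%N.
Proof.
move=> N0 a1; rewrite -(ler_nat R); apply: le_trans (floor_pow_le _ _) _.
by rewrite ler1_powR // ler1n.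
Qed.

Lemma near_floor_pow_mul (R : realType) (c : nat) (a b : R) : a < b ->
  \forall N \near \oo, (c * floor_pow a N <= floor_pow b N)%N.
Proof.
move=> ltab; near=> N.
have N0 : (0 < N)%N by near: N; exact: nbhs_infty_gt.
apply: floor_pow_ge; rewrite natrM.
have -> : b = (b - a) + a by ring.
rewrite powRD; last by rewrite pnatr_eq0 -lt0n N0 implybT.
rewrite ler_pM // ?floor_pow_le //.
by near: N; apply: near_powR_ge; rewrite subr_gt0.
Unshelve. all: by end_near. Qed.

Lemma near_error_small (R : realType) (lambda delta : R) : delta + lambda < 1 ->
  lambda <= 1 -> exists2 e : R, 0 < e & forall K eps : R, 0 < eps ->
  \forall N \near \oo, forall (b b1 : R) (h : nat),
    b <= K * N%:R `^ e -> b1 <= K * N%:R `^ e -> 0 <= b -> 0 <= b1 ->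
    b * b1 * ((floor_pow delta N)%:R * (48 * h%:R * (floor_pow lambda N)%:R *
      hsum R (floor_pow lambda N) ^+ 2)) <= eps * (N%:R * h%:R).
Proof.
(* Five factors $N^e$ fill the gap between $N^{\delta+\lambda}$ and $N$: two for [b] and [b1], two
   for the square of [hsum], one to beat the constant [A / eps]. *)
move=> ltdl lel; pose e := (1 - (delta + lambda)) / 5.
have e0 : 0 < e by rewrite /e; lra.
exists e => // K eps eps0.
pose A := K ^+ 2 * 48 * (1 + e^-1) ^+ 2.
near=> N => b b1 h leb leb1 b0 b10.
have N0 : (0 < N)%N by near: N; exact: nbhs_infty_gt.
have N1 : 1 <= N%:R :> R by rewrite ler1n.
have AP : A / eps <= N%:R `^ e by near: N; exact: near_powR_ge.
set P := N%:R `^ e in AP leb leb1 *.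
have P0 : 0 <= P by exact: powR_ge0.
have H_le : hsum R (floor_pow lambda N) <= (1 + e^-1) * P.
  apply: le_trans (hsum_le_powR _ e0) _.
  rewrite ler_wpM2l ?addr_ge0 ?invr_ge0 ?(ltW e0) // ge0_ler_powR ?nnegrE ?(ltW e0) //.
  by rewrite ler_nat floor_pow_leN.
have NE : N%:R = N%:R `^ delta * N%:R `^ lambda * P ^+ 5 :> R.
  rewrite -powR_mulrn // -powRrM -!powRD; last 2 first.
  - by rewrite pnatr_eq0 -lt0n N0 implybT.
  - by rewrite pnatr_eq0 -lt0n N0 implybT.
  have -> : delta + lambda + e * 5%:R = 1 by rewrite /e; field.
  by rewrite powRr1.
have e1 : 0 <= 1 + e^-1 by rewrite addr_ge0 ?invr_ge0 ?(ltW e0).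
apply: (@le_trans _ _ ((K * P) * (K * P) * (N%:R `^ delta *
    (48 * h%:R * N%:R `^ lambda * ((1 + e^-1) * P) ^+ 2)))).
  rewrite ler_pM ?mulr_ge0 ?exprn_ge0 ?hsum_ge0 //; first by rewrite ler_pM.
  rewrite ler_pM ?mulr_ge0 ?exprn_ge0 ?hsum_ge0 ?floor_pow_le //.
  rewrite ler_pM ?mulr_ge0 ?exprn_ge0 ?hsum_ge0 //.
    by rewrite ler_wpM2l ?mulr_ge0 // floor_pow_le.
  by rewrite lerXn2r ?nnegrE ?hsum_ge0 ?mulr_ge0.
rewrite [X in _ <= _ * (X * _)]NE.
have -> : K * P * (K * P) * (N%:R `^ delta *
    (48 * h%:R * N%:R `^ lambda * ((1 + e^-1) * P) ^+ 2)) =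
    (N%:R `^ delta * N%:R `^ lambda * h%:R * P ^+ 4) * A.
  by rewrite /A; ring.
have -> : eps * (N%:R `^ delta * N%:R `^ lambda * P ^+ 5 * h%:R) =
    (N%:R `^ delta * N%:R `^ lambda * h%:R * P ^+ 4) * (P * eps) by ring.
rewrite ler_wpM2l ?mulr_ge0 ?powR_ge0 ?exprn_ge0 //.
by rewrite -ler_pdivrMr.
Unshelve. all: by end_near. Qed.

Lemma ramanujan_coef_rsum (R : realType) (g : nat -> R) (Q l : nat) :
  (forall q, (Q < q)%N -> g q = 0) -> ramanujan_coef l (conv_one g) = rsum g Q l.
Proof. by move=> g0; rewrite (@ramanujan_coefE _ _ Q.+1). Qed.

Lemma near_symmetry_integral_error (R : realType) (theta lambda delta eps : R)
    (g1 g : nat -> nat -> R) :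
  theta <= 1 -> lambda <= 1 -> delta <= lambda -> delta + lambda < 1 ->
  sieve_weight delta g1 -> sieve_weight lambda g -> 0 < eps ->
  \forall N \near \oo,
  `|symmetry_integral (conv_one (g N)) (conv_one (g1 N)) N (floor_pow theta N) -
    2 * N%:R * \sum_(2 <= l < (floor_pow delta N).+1)
      l%:R ^+ 2 * rsum (g N) (floor_pow lambda N) l *
      rsum (g1 N) (floor_pow delta N) l *
      moebius_dist_sum R (floor_pow theta N) l| <=
  eps * (N%:R * (floor_pow theta N)%:R).
Proof.
move=> let1 lel1 ledl ltdl [g10 _ g1b] [g0 _ gb] eps0.
have [e e0 small] := near_error_small ltdl lel1.
have [C1 C1P] := g1b e e0; have [C CP] := gb e e0.
have := small (Num.max C C1) eps eps0; apply: filterS2 (nbhs_infty_gt 0) => N N0 smallN.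
have bound (c : R) (u : nat -> R) : (c <= Num.max C C1) ->
    (forall n, (0 < n)%N -> `|u n| <= c * N%:R `^ e) ->
    c * N%:R `^ e <= Num.max C C1 * N%:R `^ e /\ 0 <= c * N%:R `^ e.
  move=> lec uc; split; first by rewrite ler_wpM2r ?powR_ge0.
  by apply: le_trans (normr_ge0 _) (uc 1%N isT).
have CN n : (0 < n)%N -> `|g N n| <= C * N%:R `^ e by exact: CP.
have C1N n : (0 < n)%N -> `|g1 N n| <= C1 * N%:R `^ e by exact: C1P.
have [leC C0] := bound C (g N) (ltac:(by rewrite le_max lexx)) CN.
have [leC1 C10] := bound C1 (g1 N) (ltac:(by rewrite le_max lexx orbT)) C1N.
apply: le_trans (smallN _ _ (floor_pow theta N) leC leC1 C0 C10).
apply: symmetry_integral_error => //.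
- exact: floor_pow_leN.
- exact: le_floor_pow.
- by move=> q; exact: g0.
- by move=> d; exact: g10.
Qed.

Theorem mainTheorem1 (R : realType) :
  exists c c' : R, [/\ 0 < c, 0 < c' &
    forall (theta lambda delta : R),
      0 < theta < 1 / 2 -> 0 < lambda < 1 ->
      theta < delta < lambda -> delta + lambda < 1 ->
    forall g1 g : nat -> nat -> R,
      sieve_weight delta g1 -> sieve_weight lambda g ->
    let h := floor_pow theta in
    let D := floor_pow delta in
    let Q := floor_pow lambda in
    let f1 := fun N => conv_one (g1 N) in
    let f := fun N => conv_one (g N) in
    [/\ (fun N : nat => symmetry_integral (f N) (f1 N) N (h N)
           - 2 * N%:R * \sum_(2 <= l < (D N).+1)
               l%:R ^+ 2 * ramanujan_coef l (f N) * ramanujan_coef l (f1 N)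
               * moebius_dist_sum R (h N) l)
          =o_\oo (fun N : nat => N%:R * (h N)%:R : R),
        \forall N \near \oo,
          c * (N%:R * \sum_(2 <= l < (D N %/ 2).+1)
                 (\sum_(1 <= d < (D N %/ l).+1) g1 N (l * d)%N / d%:R)
                 * (\sum_(1 <= q < (Q N %/ l).+1) g N (l * q)%N / q%:R)
                 * moebius_dist_sum R (h N) l)
            <= symmetry_integral (f N) (f1 N) N (h N) &
        (forall N l q : nat, (0 < N)%N -> (1 <= l <= Q N)%N ->
           (1 <= q <= Q N %/ l)%N -> g N q <= g N (l * q)%N) ->
        \forall N \near \oo,
          c' * (N%:R * (\sum_(1 <= q < (Q N %/ D N).+1) g N q / q%:R)
                 * \sum_(2 <= l < (D N %/ 2).+1)
                     (\sum_(1 <= d < (D N %/ l).+1) g1 N (l * d)%N / d%:R)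
                     * moebius_dist_sum R (h N) l)
            <= symmetry_integral (f N) (f1 N) N (h N)]].
Proof.
(* Both constants are $1$: the main term is $2NS$ with $S\ge h/2$, and an error of at most $Nh/2\le
   NS$ leaves at least $NS$. *)
exists 1, 1; split=> // theta lambda delta /andP[t0 t2] /andP[l0 l1] /andP[td dl] dl1.
move=> g1 g w1 w h D Q f1 f.
have [[g10 g1_ge1 _] [g0 g_ge1 _]] := (w1, w).
have err eps : 0 < eps -> \forall N \near \oo, _ :=
  @near_symmetry_integral_error R theta lambda delta eps g1 g
    (ltac:(lra)) (ltW l1) (ltW dl) dl1 w1 w.
have lower : \forall N \near \oo,
    N%:R * \sum_(2 <= l < (D N %/ 2).+1)
      (\sum_(1 <= d < (D N %/ l).+1) g1 N (l * d)%N / d%:R)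
      * (\sum_(1 <= q < (Q N %/ l).+1) g N (l * q)%N / q%:R)
      * moebius_dist_sum R (h N) l
    <= symmetry_integral (f N) (f1 N) N (h N).
  near=> N.
  have N0 : (0 < N)%N by near: N; exact: nbhs_infty_gt.
  apply: symmetry_integral_ge.
  - rewrite le_floor_pow ?(ltW dl) // andbT.
    by near: N; exact: near_floor_pow_mul.
  - by move=> q; exact: g_ge1.
  - by move=> d; exact: g1_ge1.
  - by near: N; apply: err; rewrite invr_gt0.
split.
- apply/eqoP => eps eps0; near=> N.
  have N0 : (0 < N)%N by near: N; exact: nbhs_infty_gt.
  have -> : `|N%:R * (h N)%:R : R| = N%:R * (h N)%:R by rewrite ger0_norm ?mulr_ge0.
  under eq_bigr => l _.
    rewrite /f /f1 (@ramanujan_coef_rsum _ (g N) (Q N)); last by move=> q; exact: g0.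
    rewrite (@ramanujan_coef_rsum _ (g1 N) (D N)); last by move=> d; exact: g10.
    over.
  by near: N; exact: err.
- by apply: filterS lower => N; rewrite mul1r.
- move=> gl; apply: filterS2 (nbhs_infty_gt 0) lower => N N0.
  apply: le_trans; rewrite mul1r -mulrA ler_wpM2l // le_sum_dilate //.
  + by move=> q /(g_ge1 _ _ N0); exact: le_trans.
  + by move=> d /(g1_ge1 _ _ N0); exact: le_trans.
  + by move=> l q; exact: gl.
  + by rewrite le_floor_pow // ltW.
Unshelve. all: by end_near. Qed.
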